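(* Let $X$ be a Banach space and let $K$ be a compact subset of $X$. Assume that $(A,D(A))$ is the infinitesimal generator of a $C_0$-semigroup $(T(t))_{t\ge 0}$ on $X$, that $T(t)$ is a compact operator for each $t>0$, and that $f(t,x)=\varphi(t)g(x)+\psi(t)$, where $\varphi\in AAS^1(\mathbb{R},\mathbb{R})\cap L^\infty(\mathbb{R},\mathbb{R})$, $\psi\in AAS^1(\mathbb{R},X)$, and $g:X\to X$ is continuous and maps bounded subsets of $X$ into bounded subsets. Assume moreover that the equation $x'(t)=Ax(t)+f(t,x(t))$ has at least one mild solution $x_0$ defined and bounded on $[t_0,+\infty)$. Then the following hold: (i) If $\lambda_K$ is a subvariant functional associated to the compact set $K$, then the equation $x'(t)=Ax(t)+f(t,x(t))$, $t\in\mathbb{R}$, has at least one minimal $K$-valued solution $x$. (ii) If the equation $x'(t)=Ax(t)+f(t,x(t))$, $t\in\mathbb{R}$, has a unique minimal $K$-valued solution $x$, then $x$ is compact almost automorphic.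
   Context: Mild solution on an interval $J$ (here $J=\mathbb{R}$ or $J=[t_0,\infty)$ with $t_0\in\mathbb{R}$): a continuous $x:J\to X$ with $x(t)=T(t-\sigma)x(\sigma)+\int_\sigma^t T(t-s)f(s,x(s))\,ds$ for all $t\ge\sigma$ in $J$. For a Banach space $Y$, $AAS^1(\mathbb{R},Y)$ is the set of $u\in L^1_{loc}(\mathbb{R},Y)$ such that every real sequence has a subsequence $(s_n)$ and a function $v\in L^1_{loc}(\mathbb{R},Y)$ with, for each $t\in\mathbb{R}$, $\lim_n\int_t^{t+1}\|u(s+s_n)-v(s)\|ds=0$ and $\lim_n\int_t^{t+1}\|v(s-s_n)-u(s)\|ds=0$. Compact almost automorphic: a continuous $x:\mathbb{R}\to X$ such that every real sequence has a subsequence $(s_n)$ and a function $y:\mathbb{R}\to X$ with $x(t+s_n)\to y(t)$ and $y(t-s_n)\to x(t)$, uniformly for $t$ in compact subsets of $\mathbb{R}$. For the compact set $K\subset X$: $C_K(\mathbb{R},X)=\{x\in C(\mathbb{R},X): x(t)\in K\ \forall t\in\mathbb{R}\}$, and $\mathcal{F}_K$ is the set of mild solutions on $\mathbb{R}$ of the equation lying in $C_K(\mathbb{R},X)$. A subvariant functional associated to $K$ is a map $\lambda_K:C_K(\mathbb{R},X)\to\mathbb{R}$ such that $\lambda_K(x(\tau+\cdot))=\lambda_K(x)$ for every $\tau\in\mathbb{R}$, and $\lambda_K(y)\le\liminf_n\lambda_K(x_n)$ whenever $x_n\to y$ uniformly on each compact subset of $\mathbb{R}$. A minimal $K$-valued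 solution (with respect to $\lambda_K$) is an $x_*\in\mathcal{F}_K$ with $\lambda_K(x_* )=\inf_{x\in\mathcal{F}_K}\lambda_K(x)$.
   Formalization: Part (i) additionally assumes that K contains the range x_0([t_0,+∞)), since for arbitrary compact K it is false (A=-1 on the real line, f=0, x_0=0, K={1}); relative compactness of this range is proved as an extra conclusion. *)

(* Defs.v *)
From HB Require Import structures.
From mathcomp Require Import all_boot all_order all_algebra.
From mathcomp Require Import all_classical all_reals all_analysis.

Set Implicit Arguments.
Unset Strict Implicit.
Unset Printing Implicit Defensive.

Import Order.TTheory GRing.Theory Num.Theory.
Import numFieldNormedType.Exports.

Local Open Scope classical_set_scope.
Local Open Scope ring_scope.

(* Vector-valued (Bochner) integration on the real line *)

Definition simple_fct (R : realType) (Y : normedModType R) (s : R -> Y) : Prop :=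
  finite_set (range s) /\ forall y : Y, measurable (s @^-1` [set y]).

(* Meaningful when [D] is measurable of finite measure. *)
Definition simple_integral (R : realType) (Y : normedModType R)
    (D : set R) (s : R -> Y) : Y :=
  \sum_(y \in range s)
    fine (@lebesgue_measure R (D `&` s @^-1` [set y])) *: y.

(* [u] is a.e. on [D] the pointwise limit of simple functions; values of [u]
   outside [D] are irrelevant.  Simple functions are Borel, and since the limit
   is only a.e. all Lebesgue-a.e. representatives are covered. *)
Definition strongly_measurable (R : realType) (Y : normedModType R)
    (D : set R) (u : R -> Y) : Prop :=
  exists s : nat -> R -> Y, (forall n, simple_fct (s n)) /\
    {ae @lebesgue_measure R,
      forall r, D r -> (fun n => s n r) @ \oo --> u r}.

(* [u] is Bochner integrable on [D], with integral [v].  Below, [\int] of a norm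
   is always that of an a.e. limit of Borel functions; for such a function, even
   if not itself Borel, [\int] (a supremum over Borel simple minorants) agrees
   with the usual Lebesgue integral. *)
Definition is_bochner_integral (R : realType) (Y : normedModType R)
    (D : set R) (u : R -> Y) (v : Y) : Prop :=
  exists s : nat -> R -> Y, [/\
    (forall n, simple_fct (s n)),
    {ae @lebesgue_measure R,
      forall r, D r -> (fun n => s n r) @ \oo --> u r},
    (fun n => \int[@lebesgue_measure R]_(r in D) (`|s n r - u r|)%R%:E)%E
      @ \oo --> 0%E &
    (fun n => simple_integral D (s n)) @ \oo --> v].

Definition L1_loc (R : realType) (Y : normedModType R) (u : R -> Y) : Prop :=
  strongly_measurable setT u /\
  forall a b : R,
    (\int[@lebesgue_measure R]_(r in `[a, b]) (`|u r|)%R%:E < +oo)%E.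

(* Almost automorphy *)

Definition AAS1 (R : realType) (Y : normedModType R) (u : R -> Y) : Prop :=
  L1_loc u /\
  forall s' : nat -> R, exists (k : nat -> nat) (v : R -> Y),
    [/\ {homo k : m n / (m < n)%N >-> (m < n)%N},
        L1_loc v &
        forall t : R,
          (fun n => \int[@lebesgue_measure R]_(r in `[t, (t + 1)%R])
                      (`|u (r + s' (k n)) - v r|)%R%:E)%E @ \oo --> 0%E /\
          (fun n => \int[@lebesgue_measure R]_(r in `[t, (t + 1)%R])
                      (`|v (r - s' (k n)) - u r|)%R%:E)%E @ \oo --> 0%E].

Definition compact_almost_automorphic (R : realType) (X : normedModType R)
    (x : R -> X) : Prop :=
  continuous x /\
  forall s' : nat -> R, exists (k : nat -> nat) (y : R -> X),
    [/\ {homo k : m n / (m < n)%N >-> (m < n)%N},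
        {family compact, (fun n (t : R) => x (t + s' (k n))) @ \oo --> y} &
        {family compact, (fun n (t : R) => y (t - s' (k n))) @ \oo --> x}].

(* Semigroups; only the operators [T t] with [0 <= t] matter. *)

Definition C0_semigroup (R : realType) (X : normedModType R)
    (T : R -> {linear X -> X}) : Prop :=
  [/\ forall t : R, 0 <= t -> continuous (T t),
      forall x : X, T 0 x = x,
      forall (s t : R) (x : X), 0 <= s -> 0 <= t -> T (s + t) x = T s (T t x) &
      forall x : X, T t x @[t --> 0^'+] --> x].

(* The operator [A] with domain [D] is encoded by a total function whose values
   outside [D] are irrelevant. *)
Definition infinitesimal_generator (R : realType) (X : normedModType R)
    (T : R -> {linear X -> X}) (D : set X) (A : X -> X) : Prop :=
  D = [set x | cvg (h^-1 *: (T h x - x) @[h --> (0 : R)^'+])] /\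
  forall x : X, D x -> h^-1 *: (T h x - x) @[h --> (0 : R)^'+] --> A x.

Definition compact_operator (R : realType) (X : normedModType R)
    (S : X -> X) : Prop :=
  forall B : set X, bounded_set B -> precompact (S @` B).

Definition mild_solution (R : realType) (X : normedModType R)
    (T : R -> {linear X -> X}) (f : R -> X -> X) (J : set R)
    (x : R -> X) : Prop :=
  {within J, continuous x} /\
  forall sigma t : R, J sigma -> J t -> sigma <= t ->
    is_bochner_integral `[sigma, t] (fun s => T (t - s) (f s (x s)))
      (x t - T (t - sigma) (x sigma)).

(* Subvariant functionals and minimal solutions *)

Definition C_K (R : realType) (X : normedModType R) (K : set X) :
    set (R -> X) :=
  [set x | continuous x /\ forall t, K (x t)].

Definition F_K (R : realType) (X : normedModType R)
    (T : R -> {linear X -> X}) (f : R -> X -> X) (K : set X) :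
    set (R -> X) :=
  [set x | mild_solution T f setT x /\ C_K K x].

(* The functional lives on [C_K K]; its values elsewhere are never used. *)
Definition subvariant (R : realType) (X : normedModType R) (K : set X)
    (lam : (R -> X) -> R) : Prop :=
  (forall (x : R -> X) (tau : R), C_K K x ->
     lam (fun t => x (tau + t)) = lam x) /\
  (forall (x_ : nat -> R -> X) (y : R -> X),
     (forall n, C_K K (x_ n)) -> C_K K y ->
     {family compact, x_ @ \oo --> y} ->
     ((lam y)%:E <= limn_einf (fun n => (lam (x_ n))%:E))%E).

(* The infimum is taken in the extended reals: the library's real-valued [inf]
   has a default value on sets that are not bounded below. *)
Definition minimal_solution (R : realType) (X : normedModType R)
    (T : R -> {linear X -> X}) (f : R -> X -> X) (K : set X)
    (lam : (R -> X) -> R) (x : R -> X) : Prop :=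
  F_K T f K x /\
  (lam x)%:E = ereal_inf [set (lam y)%:E | y in F_K T f K].

(* Main.v *)
Require Import Defs.
From HB Require Import structures.
From mathcomp Require Import all_boot all_order all_algebra.
From mathcomp Require Import all_classical all_reals all_analysis.
From mathcomp Require Import measurable_realfun lra.

Set Implicit Arguments.
Unset Strict Implicit.
Unset Printing Implicit Defensive.

Import Order.TTheory GRing.Theory Num.Theory.
Import numFieldNormedType.Exports.

Local Open Scope classical_set_scope.
Local Open Scope ring_scope.

(* Integrals enter only through bounds, so a limit of mild solutions is mild as
   soon as the coefficients converge in L^1_loc and the solutions converge
   locally uniformly: the integrands then converge in L^1.  Solutions with values
   in [K] are uniformly equicontinuous, because T(h) - 1 is uniformly small on
   [K] for small h and AAS^1 functions are uniformly integrable; hence sequences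
   of them are precompact (Ascoli).  Translating the given solution along the
   integers and passing to the limit yields a solution on the line of an equation
   in the hull, and translating back one of the original equation; minimal
   solutions then exist by compactness and semicontinuity.  Translating a minimal
   solution forth and back does not increase the functional, so uniqueness forces
   the original solution to be recovered, which is compact almost automorphy. *)

(** * Upper bounds for integrals *)

(** Compactness of [T t] for positive [t] provides the compact set: it makes a bounded orbit
    relatively compact, and afterwards every sequence stays in [K]. Coefficients of a hull equation
    are recorded as locally integrable limits, without the recurrence of the original ones. Hence
    limits inherit their modulus of continuity from the approximating solutions instead of deriving
    it from their own equation, and the nonlinearity is compared through a bound and the uniform
    continuity of [g] near [K], weighted by the integral of [|phi|]. The integrand of a limit is not
    known to be measurable beforehand, so errors are carried by measurable majorants. The return
    trip in the minimality argument is forced: the forward limit solves another equation and cannot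
    compete in the infimum, while the backward limit can. *)

#[local] Instance ae_lebesgue_filter (R : realType) :
  Filter (almost_everywhere (@lebesgue_measure R)).
Proof. exact: ae_filter_ringOfSetsType. Qed.

(* "The upper integral of [f] over [D] is at most [c]".  Unlike [\int], which for
   nonmeasurable functions is a lower integral, this is subadditive without any
   measurability of [f]. *)
Definition upint (R : realType) (D : set R) (f : R -> R) (c : \bar R) : Prop :=
  exists h : R -> \bar R, [/\ measurable_fun [set: R] h, forall r, (0 <= h r)%E,
    {ae @lebesgue_measure R, forall r, D r -> ((f r)%:E <= h r)%E} &
    (\int[@lebesgue_measure R]_(r in D) h r <= c)%E].

Import HBNNSimple.
Section upint.
Context {R : realType}.
Local Notation mu := (@lebesgue_measure R).
Implicit Types (D : set R) (f g : R -> R) (c d : \bar R).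

(** The integral of a nonnegative function is a supremum over simple minorants, and on [D] each of
    these lies a.e. below the measurable majorant. *)
Lemma upint_integral D f c : measurable D -> (forall r, D r -> 0 <= f r) ->
  upint D f c -> (\int[mu]_(r in D) (f r)%:E <= c)%E.
Proof.
move=> mD f0 [h [mh h0 fh hc]]; apply: le_trans hc.
rewrite ge0_integralE; last by move=> r Dr; rewrite lee_fin f0.
apply: ge_ereal_sup => _ [s /= sf <-].
rewrite -integralT_nnsfun [leRHS]integral_mkcond.
apply: ae_ge0_le_integral => //.
- by move=> r _; rewrite lee_fin; exact: fun_ge0.
- exact/measurable_EFinP.
- by move=> r _; rewrite /patch; case: ifP.
- apply/(measurable_restrictT _ _).1 => //.
  exact: measurable_funTS.
- apply: filterS fh => r fh _; apply: le_trans (sf r) _.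
  by rewrite /patch; case: ifPn => //; rewrite inE => /fh.
Qed.

Lemma upint_le D f g c d :
  {ae mu, forall r, D r -> f r <= g r} -> (c <= d)%E ->
  upint D g c -> upint D f d.
Proof.
move=> fg cd [h [mh h0 gh hc]]; exists h; split=> //; last exact: le_trans cd.
apply: filterS2 fg gh => r fg gh Dr; apply: le_trans (gh Dr).
by rewrite lee_fin fg.
Qed.

Lemma upintD D f g c d : measurable D ->
  upint D f c -> upint D g d -> upint D (f \+ g) (c + d)%E.
Proof.
move=> mD [h [mh h0 fh hc]] [k [mk k0 gk kd]]; exists (h \+ k)%E; split.
- exact: emeasurable_funD.
- by move=> r; rewrite /= adde_ge0.
- apply: filterS2 fh gk => r fh gk Dr.
  by rewrite /= EFinD leeD ?fh ?gk.
- rewrite ge0_integralD//; [exact: leeD| exact: measurable_funTS..].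
Qed.

Lemma upintZ D f c (k : R) : measurable D -> 0 <= k ->
  upint D f c -> upint D (fun r => k * f r) (k%:E * c)%E.
Proof.
move=> mD k0 [h [mh h0 fh hc]]; exists (fun r => k%:E * h r)%E; split.
- exact: measurable_funeM.
- by move=> r; rewrite mule_ge0.
- apply: filterS fh => r fh Dr.
  by rewrite EFinM lee_wpmul2l// fh.
- rewrite ge0_integralZl_EFin//; last exact: measurable_funTS.
  by rewrite lee_wpmul2l.
Qed.

Lemma upintS D D' f c : measurable D -> measurable D' -> D' `<=` D ->
  upint D f c -> upint D' f c.
Proof.
move=> mD mD' D'D [h [mh h0 fh hc]]; exists h; split=> //.
- by apply: filterS fh => r fh /D'D.
- apply: le_trans hc; apply: ge0_subset_integral => //.
  exact: measurable_funTS.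
Qed.

Lemma upint0 D c : (0 <= c)%E -> upint D (fun=> 0) c.
Proof.
move=> c0; exists (fun=> 0%E); split => //; last by rewrite integral0.
by apply: aeW => r _.
Qed.

(* The two majorants may differ on the overlap, so they are glued. *)
Lemma upintU D D' f c d : measurable D -> measurable D' ->
  upint D f c -> upint D' f d -> upint (D `|` D') f (c + d)%E.
Proof.
move=> mD mD' [h [mh h0 fh hc]] [k [mk k0 fk kd]].
exists ((h \_ D) \+ (k \_ D'))%E; split.
- apply: emeasurable_funD;
    by apply/(measurable_restrictT _ _).1 => //; exact: measurable_funTS.
- by move=> r; rewrite adde_ge0// /patch; case: ifP.
- apply: filterS2 fh fk => r fh fk [Dr|Dr] /=.
    rewrite {1}/patch mem_set//.
    by apply: (le_trans (fh Dr)); rewrite leeDl// /patch; case: ifP.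
  rewrite [X in (_ <= _ + X)%E]/patch mem_set//.
  by apply: (le_trans (fk Dr)); rewrite leeDr// /patch; case: ifP.
- have mDD : measurable (D `|` D') by exact: measurableU.
  rewrite ge0_integralD//; last 4 first.
  + by move=> r _; rewrite /patch; case: ifP.
  + apply: measurable_funTS.
    by apply/(measurable_restrictT _ _).1 => //; exact: measurable_funTS.
  + by move=> r _; rewrite /patch; case: ifP.
  + apply: measurable_funTS.
    by apply/(measurable_restrictT _ _).1 => //; exact: measurable_funTS.
  rewrite -!integral_mkcondr (_ : (D `|` D') `&` D = D); last first.
    by apply/setIidr; exact: subsetUl.
  rewrite (_ : (D `|` D') `&` D' = D'); last by apply/setIidr; exact: subsetUr.
  exact: leeD.
Qed.

(** Uniqueness of Lebesgue measure: the pushforward agrees with it on half-open intervals. *)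
Lemma lebesgue_measureD (a : R) (A : set R) : measurable A ->
  pushforward mu ((fun r => r + a) : _ -> measurableTypeR R) A = mu A.
Proof.
have mD : measurable_fun [set: R] (fun r : R => r + a).
  exact: measurable_funD.
move=> mA; apply/esym/lebesgue_measure_unique => //= _ [[x y]] _ <-.
rewrite /pushforward (_ : _ @^-1` _ = `]x - a, y - a]%classic); last first.
  by apply/seteqP; split=> r /=; rewrite !in_itv /= ltrBlDr lerBrDr.
rewrite !lebesgue_measure_itv/= !lte_fin ltrD2r.
by case: ifP => // _; congr (_%:E); rewrite opprB addrA subrK.
Qed.

Lemma negligibleD (a : R) (A : set R) : mu.-negligible A ->
  mu.-negligible ((fun r => r + a) @^-1` A).
Proof.
have mD : measurable_fun [set: R] (fun r : R => r + a).
  exact: measurable_funD.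
move=> [N [mN N0 AN]]; exists ((fun r => r + a) @^-1` N); split.
- by rewrite -[X in measurable X]setTI; exact: mD.
- by rewrite -[RHS]N0 -(lebesgue_measureD a mN).
- by move=> r; exact: AN.
Qed.

Lemma aeD (a : R) (P : R -> Prop) :
  {ae mu, forall r, P r} -> {ae mu, forall r, P (r + a)}.
Proof. by move=> h; apply: (negligibleD a h). Qed.

Lemma upint_shift (a : R) D f c : measurable D -> upint D f c ->
  upint ((fun r => r + a) @^-1` D) (fun r => f (r + a)) c.
Proof.
have mD : measurable_fun [set: R] (fun r : R => r + a).
  exact: measurable_funD.
move=> mDD [h [mh h0 fh hc]]; exists (fun r => h (r + a)); split=> //.
- exact: measurableT_comp.
- exact: (aeD a fh).
- apply: le_trans hc.
  have := @ge0_integral_pushforward _ _ (measurableTypeR R) (measurableTypeR R)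
    R (fun r => r + a) mD lebesgue_measure D h mDD.
  move=> /(_ (measurable_funTS mh) (fun r _ => h0 r)) <-.
  rewrite le_eqVlt; apply/orP; left; apply/eqP.
  by apply: eq_measure_integral => //= A mA _; exact/lebesgue_measureD.
Qed.

End upint.

(** * Bochner integral *)

Section simple.
Context {R : realType} {Y : normedModType R}.
Local Notation mu := (@lebesgue_measure R).
Implicit Types (s t : R -> Y) (D : set R).

(** The range is finite, so the preimage is a finite union of measurable fibres; hence [B] is
    arbitrary and [Y] carries no sigma-algebra. *)
Lemma simple_fct_preimage s (B : set Y) : simple_fct s -> measurable (s @^-1` B).
Proof.
move=> [fs ms]; rewrite (_ : _ @^-1` _ =
    \bigcup_(y in range s `&` B) (s @^-1` [set y])).
  apply: fin_bigcup_measurable => [|y _]; last exact: ms.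
  by apply: sub_finite_set fs => y [].
apply/seteqP; split => [r Br|r [y [_ By]] /= ->//].
by exists (s r) => //; split=> //; exists r.
Qed.

Lemma simple_fctB s t : simple_fct s -> simple_fct t -> simple_fct (s \- t).
Proof.
move=> ss st; split.
  apply: (@sub_finite_set _ _ ((fun p => p.1 - p.2) @` (range s `*` range t))).
    by move=> _ [r _ <-]; exists (s r, t r) => //; split; exists r.
  by apply/finite_image/finite_setX; [case: ss|case: st].
move=> y; rewrite (_ : _ @^-1` _ =
    \bigcup_(z in range s) (s @^-1` [set z] `&` t @^-1` [set z - y])).
  apply: fin_bigcup_measurable => [|z _]; first by case: ss.
  by apply: measurableI; exact: simple_fct_preimage.
apply/seteqP; split => [r /= <-|r [z _ [/= -> ->]]] /=.
  by exists (s r); [exists r|split=> //=; rewrite opprB addrC subrK].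
by rewrite opprB addrC subrK.
Qed.

Lemma simple_fct_shift (a : R) s : simple_fct s -> simple_fct (fun r => s (r + a)).
Proof.
have mD : measurable_fun [set: R] (fun r : R => r + a) by exact: measurable_funD.
move=> [fs ms]; split.
  by apply: sub_finite_set fs => _ [r _ <-]; exists (r + a).
move=> y; have := mD measurableT _ (ms y); rewrite setTI; exact.
Qed.

Lemma simple_fct_norm s : simple_fct s ->
  measurable_fun [set: R] (fun r => `|s r|).
Proof.
move=> ss _ B mB; rewrite setTI.
exact: (simple_fct_preimage ((fun y : Y => `|y|) @^-1` B) ss).
Qed.

(** Triangle inequality, after writing [|s|] as a finite combination of indicators of fibres.
    Finiteness of [mu D] prevents [fine] from turning an infinite measure into 0. *)
Lemma simple_integral_norm D s : measurable D -> (mu D < +oo)%E ->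
  simple_fct s -> (`|simple_integral D s|%:E <= \int[mu]_(r in D) `|s r|%:E)%E.
Proof.
move=> mD Doo ss; have [fs ms] := ss.
have -> : (\int[mu]_(r in D) `|s r|%:E)%E =
    (\int[mu]_(r in D) (\sum_(y \in range s) (`|y| * \1_(s @^-1` [set y]) r)%:E))%E.
  apply: eq_integral => r _; rewrite (fsbigD1 (s r))//=; last by exists r.
  rewrite fsbig1 ?adde0; last first.
    move=> y [_ /= ysr]; rewrite indicE memNset ?mulr0// => sry.
    by apply: ysr; rewrite -sry.
  by rewrite indicE mem_set// mulr1.
rewrite ge0_integral_fsum; last 4 first.
- exact: mD.
- move=> y; apply/measurable_EFinP; apply: measurable_funTS.
  by apply: measurable_funM => //; apply: measurable_indic; exact: ms.
- by move=> y r _; rewrite lee_fin mulr_ge0.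
- exact: fs.
rewrite (eq_fsbigr (fun y => (fine (mu (D `&` s @^-1` [set y])) * `|y|)%:E)).
  rewrite fsumEFin// lee_fin /simple_integral !fsbig_finite//=.
  apply: (le_trans (ler_norm_sum _ _ _)).
  by apply: ler_sum => y _; rewrite normrZ ger0_norm// fine_ge0.
move=> y _; under eq_integral do rewrite EFinM.
rewrite ge0_integralZl_EFin; last 4 first.
- exact: mD.
- by move=> r _; rewrite lee_fin.
- apply/measurable_EFinP; apply: measurable_funTS.
  by apply: measurable_indic; exact: ms.
- exact: normr_ge0.
rewrite integral_indic//; last exact: ms.
rewrite EFinM fineK; first by rewrite muleC setIC.
rewrite ge0_fin_numE//; apply: le_lt_trans Doo.
apply: le_measure; rewrite ?inE; [|exact: mD|exact: subIsetl].
by apply: measurableI; [exact: mD|exact: ms].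
Qed.

Lemma strongly_measurableS D D' (u : R -> Y) : D' `<=` D ->
  strongly_measurable D u -> strongly_measurable D' u.
Proof.
move=> D'D [s [ss su]]; exists s; split => //.
by apply: filterS su => r su /D'D.
Qed.

Lemma strongly_measurableB D (u v : R -> Y) :
  strongly_measurable D u -> strongly_measurable D v ->
  strongly_measurable D (u \- v).
Proof.
move=> [s [ss su]] [t [st tv]]; exists (fun n => s n \- t n).
split=> [n|]; first exact: simple_fctB.
by apply: filterS2 su tv => r su tv Dr; apply: cvgB; [exact: su|exact: tv].
Qed.

Lemma strongly_measurable_shift (a : R) (u : R -> Y) :
  strongly_measurable setT u -> strongly_measurable setT (fun r => u (r + a)).
Proof.
move=> [s [ss su]]; exists (fun n r => s n (r + a)).
split=> [n|]; first exact: simple_fct_shift.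
by apply: filterS (aeD a su) => r + _; apply.
Qed.

(** The way back from [\int] to [upint]: the Borel majorant is the upper limit of the norms of the
    approximating simple functions. *)
Lemma strongly_measurable_upint D (u : R -> Y) : measurable D ->
  strongly_measurable D u ->
  upint D (fun r => `|u r|) (\int[mu]_(r in D) `|u r|%:E)%E.
Proof.
move=> mD [s [ss su]].
pose h r := limn_esup (fun n => `|s n r|%:E).
have h0 r : (0 <= h r)%E.
  rewrite /h limn_esup_lim; apply: lime_ge; first exact: is_cvg_esups.
  apply: nearW => n; apply: (@le_trans _ _ (`|s n r|%:E)); first by rewrite lee_fin.
  by apply: ereal_sup_ubound; exists n => /=.
have mh : measurable_fun [set: R] h.
  apply: measurable_fun_limn_esup => n; apply/measurable_EFinP.
  exact: simple_fct_norm.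
have hu : {ae mu, forall r, D r -> h r = `|u r|%:E}.
  apply: filterS su => r su Dr; rewrite /h.
  apply: (cvg_limn_einf_sup _).2.
  by apply: cvg_EFin; [exact: nearW|apply: cvg_norm; exact: su].
exists h; split => //; first by apply: filterS hu => r hu /hu ->.
(* [h] equals [|u|] off the null set [N], so every simple minorant of [h] on [D] minus [N], extended
   by 0, is a minorant of [|u|] on [D]. *)
have [N [mN N0 DN]] := hu.
rewrite (ge0_negligible_integral (N:=N))//; last exact: measurable_funTS.
rewrite integral_mkcond [leRHS]integral_mkcond.
rewrite !ge0_integralTE; last 2 first.
- by move=> r; rewrite /patch; case: ifP.
- by move=> r; rewrite /patch; case: ifP => //; rewrite lee_fin.
apply: ereal_sup_le => _ [g /= gh <-]; exists g => //= r.
apply: (le_trans (gh r)); rewrite /patch.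
case: ifPn; last by case: ifP; rewrite ?lee_fin.
rewrite inE => -[Dr Nr]; rewrite mem_set//.
have -> // : h r = `|u r|%:E.
by apply: contrapT => hur; apply/Nr/DN => /(_ Dr).
Qed.

End simple.

(** * Bochner integrals: norm bound, limits, translation *)

Section bochner.
Context {R : realType}.
Local Notation mu := (@lebesgue_measure R).
Implicit Types (D : set R).

Lemma cvge0_le (e : nat -> \bar R) (eps : R) : e @ \oo --> 0%E -> 0 < eps ->
  \forall n \near \oo, (e n <= eps%:E)%E.
Proof.
move=> /fine_cvgP[efin e0] eps0; near=> n.
have : e n \is a fin_num by near: n.
move=> /fineK <-; rewrite lee_fin; apply: ltW.
by near: n; exact: cvgr_lt e0 _ eps0.
Unshelve. all: by end_near. Qed.

Lemma ge0_cvge0 (e : nat -> \bar R) : (forall n, (0 <= e n)%E) ->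
  (forall eps : R, 0 < eps -> \forall n \near \oo, (e n <= eps%:E)%E) ->
  e @ \oo --> 0%E.
Proof.
move=> e0 H; apply/fine_cvgP; split.
  apply: filterS (H 1 ltr01) => n en.
  by rewrite ge0_fin_numE//; apply: le_lt_trans en _; exact: ltry.
apply/cvgr0Pnorm_le => eps eps0; apply: filterS (H _ eps0) => n en /=.
rewrite ger0_norm ?fine_ge0// -lee_fin fineK//.
by rewrite ge0_fin_numE//; apply: le_lt_trans en _; exact: ltry.
Qed.

Lemma summable_sequence : exists eps : nat -> R,
  [/\ forall k, 0 < eps k, eps @ \oo --> (0 : R) &
      (\sum_(k <oo) (eps k)%:E < +oo)%E].
Proof.
have c : eseries (fun k => (1 / (2 ^ (k + 1))%:R)%:E) @ \oo --> (1%:E : \bar R).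
  have := @cvg_geometric_eseries_half R 1 0.
  by rewrite expr0 divr1.
exists (fun k => 1 / (2 ^ (k + 1))%:R); split=> [k||].
- by rewrite divr_gt0// ltr0n expn_gt0.
- apply/cvgr0Pnorm_le => e e0; near=> n.
  rewrite ger0_norm// div1r.
  have n0 : (0 < n)%N by near: n; exists 1%N.
  apply: (@le_trans _ _ (n%:R^-1)).
    rewrite lef_pV2 ?posrE ?ltr0n ?expn_gt0// ler_nat.
    by rewrite ltnW// (leq_ltn_trans (leq_addr 1 n))// ltn_expl.
  near: n; exists (Num.trunc e^-1).+1 => //= n /= en.
  rewrite -[leRHS]invrK lef_pV2 ?posrE ?invr_gt0 ?ltr0n//; last exact: leq_ltn_trans en.
  apply: (le_trans (ltW (truncnS_gt _))).
  by rewrite ler_nat.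
- by have -> := cvg_lim _ c => //; rewrite ltry.
Unshelve. all: by end_near. Qed.

(** The sum of the majorants has finite integral, hence is finite a.e.; there its tails, which
    dominate [z n], tend to 0. *)
Lemma upint_ae_cvg0 D (z : nat -> R -> R) (c : nat -> \bar R) : measurable D ->
  (forall n r, D r -> 0 <= z n r) -> (forall n, upint D (z n) (c n)) ->
  (\sum_(n <oo) c n < +oo)%E ->
  {ae mu, forall r, D r -> (fun n => z n r) @ \oo --> (0 : R)}.
Proof.
move=> mD z0 /(_ _)/cid - /all_sig[h hh] cfin.
have h0 n r : (0 <= h n r)%E by case: (hh n).
have mh n : measurable_fun [set: R] (h n) by case: (hh n).
have mS : measurable_fun [set: R] (fun r => (\sum_(n <oo) h n r)%E).
  by apply: ge0_emeasurable_sum => // *; exact: h0.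
have iS : mu.-integrable D (fun r => (\sum_(n <oo) h n r)%E).
  apply/integrableP; split; first exact: measurable_funTS.
  have -> : (\int[mu]_(r in D) `|\sum_(n <oo) h n r| =
      \int[mu]_(r in D) (\sum_(n <oo) h n r))%E.
    by apply: eq_integral => r _; rewrite gee0_abs// nneseries_ge0.
  have -> : (\int[mu]_(r in D) (\sum_(n <oo) h n r) =
      \sum_(n <oo) \int[mu]_(r in D) h n r)%E.
    by apply: integral_nneseries => // n; exact: (measurable_funTS (mh n)).
  apply: le_lt_trans cfin; apply: lee_nneseries => n *; last by case: (hh n).
  exact: integral_ge0.
have aeh : {ae mu, forall r, forall n, D r -> ((z n r)%:E <= h n r)%E}.
  by apply: ae_foralln => n; case: (hh n).
have aeS : {ae mu, forall r, D r -> (\sum_(n <oo) h n r)%E \is a fin_num}.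
  by apply: integrable_ae; [exact: mD|exact: iS].
apply: filterS2 aeS aeh => r fS zh Dr.
have {}fS : (\sum_(n <oo) h n r < +oo)%E.
  by rewrite -ge0_fin_numE ?fS// nneseries_ge0.
have tail := nneseries_tail_cvg fS (fun k _ => h0 k r).
apply/cvgr0Pnorm_le => e e0; apply: filterS (cvge0_le tail e0) => n ne.
rewrite ger0_norm ?z0// -lee_fin; apply: le_trans (zh n Dr) _.
apply: le_trans ne.
have := @nneseries_lim_ge R (h ^~ r) xpredT n n.+1 (fun k _ _ => h0 k r).
by rewrite big_nat1.
Qed.

Section vector.
Context {Y : normedModType R}.
Implicit Types (u : R -> Y) (v : Y).

Lemma is_bochner_integral_measurable D u v :
  is_bochner_integral D u v -> strongly_measurable D u.
Proof. by move=> [s [ss su _ _]]; exists s. Qed.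

Lemma simple_fct_strongly_measurable D (s : R -> Y) :
  simple_fct s -> strongly_measurable D s.
Proof.
by move=> ss; exists (fun=> s); split=> //; apply: aeW => r _; exact: cvg_cst.
Qed.

(** The integral of [s n] has norm at most the integral of [|s n - u|] plus [c]; the first term
    vanishes in the limit. *)
Lemma bochner_norm D u v c : measurable D -> (mu D < +oo)%E ->
  is_bochner_integral D u v -> upint D (fun r => `|u r|) c ->
  (`|v|%:E <= c)%E.
Proof.
move=> mD Doo uv uc; have um := is_bochner_integral_measurable uv.
have [s [ss su sc sv]] := uv.
have c0 : (0 <= c)%E.
  apply: le_trans (upint_integral mD _ uc) => //.
  by apply: integral_ge0 => r _; rewrite lee_fin.
move: c uc c0 => [c||] uc c0; [|by rewrite leey|by []].
have cv : (fun n => `|simple_integral D (s n)|%:E) @ \oo --> `|v|%:E.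
  by apply: cvg_EFin; [exact: nearW|exact: cvg_norm].
have cr : (fun n => \int[mu]_(r in D) `|s n r - u r|%:E + c%:E)%E @ \oo --> c%:E.
  rewrite -[X in _ --> X]add0e; apply: cvgeD => //; exact: cvg_cst.
rewrite -(cvg_lim _ cv)// -(cvg_lim _ cr)//.
apply: lee_lim; [exact: cvgP cv|exact: cvgP cr|apply: nearW => n].
apply: le_trans (simple_integral_norm mD Doo (ss n)) _.
apply: upint_integral => //.
have sm : strongly_measurable D (s n \- u).
  by apply: strongly_measurableB => //; exact: simple_fct_strongly_measurable.
apply: upint_le (upintD mD (strongly_measurable_upint mD sm) uc) => //.
by apply: aeW => r _ /=; rewrite -{1}[s n r](subrK (u r)) ler_normD.
Qed.

(* A diagonal choice of simple functions with summable L^1 errors; summability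
   gives the almost everywhere convergence required by the definition. *)
Lemma bochner_limit D (u : nat -> R -> Y) (v : nat -> Y) U V
    (w : nat -> R -> R) (c : nat -> \bar R) : measurable D ->
  (forall n, is_bochner_integral D (u n) (v n)) ->
  (forall n r, D r -> `|u n r - U r| <= w n r) ->
  (forall n, upint D (w n) (c n)) -> c @ \oo --> 0%E -> v @ \oo --> V ->
  is_bochner_integral D U V.
Proof.
move=> mD uv uU wc c0 vV.
have [eps [eps0 epsc epss]] := summable_sequence.
have /choice[k kP] n : exists m, (c m <= (eps n)%:E)%E /\ `|v m - V| <= eps n.
  have h1 := cvge0_le c0 (eps0 n).
  have h2 : \forall m \near \oo, `|v m - V| <= eps n by apply: cvgr_distC_le.
  by have [m [? ?]] := filter_ex (filterI h1 h2); exists m.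
have /choice[s sP] n : exists s, [/\ simple_fct s,
    (\int[mu]_(r in D) `|s r - u (k n) r|%:E <= (eps n)%:E)%E &
    `|simple_integral D s - v (k n)| <= eps n].
  have [s [ss su sc sv]] := uv (k n).
  have h1 := cvge0_le sc (eps0 n).
  have h2 : \forall m \near \oo, `|simple_integral D (s m) - v (k n)| <= eps n.
    exact: cvgr_distC_le.
  by have [m [? ?]] := filter_ex (filterI h1 h2); exists (s m).
(* [U] is not known to be measurable, so [|s n - U|] is handled through the dominating function
   [z n], whose upper integral is at most [2 * eps n]. *)
pose z n r := `|s n r - u (k n) r| + w (k n) r.
have zs n : upint D (z n) ((eps n)%:E + (eps n)%:E)%E.
  apply: upintD => //.
    have sm : strongly_measurable D (s n \- u (k n)).
      apply: strongly_measurableB; last exact: is_bochner_integral_measurable (uv _).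
      by apply: simple_fct_strongly_measurable; case: (sP n).
    apply: upint_le (strongly_measurable_upint mD sm); first by apply: aeW.
    by case: (sP n).
  by apply: upint_le (wc (k n)); [apply: aeW|case: (kP n)].
have w0 n r : D r -> 0 <= w n r by move=> /(uU n r); exact: le_trans.
have z0 n r : D r -> 0 <= z n r by move=> Dr; rewrite addr_ge0// w0.
have sz n r : D r -> `|s n r - U r| <= z n r.
  move=> Dr; rewrite -(subrKA (u (k n) r)).
  by apply: (le_trans (ler_normD _ _)); rewrite lerD2l uU.
have ez : {ae mu, forall r, D r -> (fun n => z n r) @ \oo --> (0 : R)}.
  apply: upint_ae_cvg0 zs _ => //.
  rewrite nneseriesD; [|by move=> n _; rewrite lee_fin ltW..].
  exact: lte_add_pinfty.
exists s; split.
- by move=> n; case: (sP n).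
- apply: filterS ez => r ez Dr.
  apply/subr_cvg0; apply: norm_cvg0.
  apply: squeeze_cvgr (cvg_cst 0) (ez Dr).
  by apply: nearW => n; rewrite normr_ge0 sz.
- apply: ge0_cvge0 => [n|e e0].
    by apply: integral_ge0 => r _; rewrite lee_fin.
  have e20 : 0 < e / 2 by rewrite divr_gt0.
  apply: filterS (cvgr_le _ epsc _ e20) => n ne.
  apply: (@le_trans _ _ ((eps n)%:E + (eps n)%:E)%E).
    apply: upint_integral => //; apply: upint_le (zs n) => //.
    by apply: aeW => r Dr; exact: sz.
  by rewrite -EFinD lee_fin [leRHS](splitr e) lerD.
- apply/subr_cvg0; apply: norm_cvg0.
  apply: (@squeeze_cvgr _ _ _ _ (cst 0) (fun n => eps n + eps n)).
  + apply: nearW => n; rewrite normr_ge0/= -(subrKA (v (k n))).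
    apply: (le_trans (ler_normD _ _)).
    by rewrite lerD//; [case: (sP n)|case: (kP n)].
  + exact: cvg_cst.
  + by rewrite -[X in _ --> X](addr0 0); exact: cvgD.
Qed.

Lemma bochner_shift (a : R) D u v : measurable D -> is_bochner_integral D u v ->
  is_bochner_integral ((fun r => r + a) @^-1` D) (fun r => u (r + a)) v.
Proof.
have mA : measurable_fun [set: R] (fun r : R => r + a) by exact: measurable_funD.
move=> mD uv; have um := is_bochner_integral_measurable uv.
have [s [ss su sc sv]] := uv.
have mDa : measurable ((fun r => r + a) @^-1` D).
  by have := mA measurableT _ mD; rewrite setTI.
exists (fun n r => s n (r + a)); split.
- by move=> n; exact: simple_fct_shift.
- exact: (aeD a su).
- apply: ge0_cvge0 => [n|e e0].
    by apply: integral_ge0 => r _; rewrite lee_fin.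
  apply: filterS (cvge0_le sc e0) => n ne; apply: upint_integral => //.
  apply: (@upint_shift _ a D (fun r => `|s n r - u r|)) => //.
  have sm : strongly_measurable D (s n \- u).
    by apply: strongly_measurableB => //; exact: simple_fct_strongly_measurable.
  by apply: upint_le (strongly_measurable_upint mD sm) => //; apply: aeW.
- suff -> : (fun n => simple_integral ((fun r => r + a) @^-1` D)
      (fun r => s n (r + a))) = (fun n => simple_integral D (s n)) by [].
  apply/funext => n; rewrite /simple_integral.
  have -> : range (fun r => s n (r + a)) = range (s n).
    apply/seteqP; split=> _ [r _ <-]; first by exists (r + a).
    by exists (r - a) => //; rewrite subrK.
  apply: eq_fsbigr => y _; congr (fine _ *: _).
  have := lebesgue_measureD a (measurableI _ _ mD ((ss n).2 y)).
  by rewrite /pushforward preimage_setI.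
Qed.

End vector.
End bochner.

(** * Semigroups *)

Section compactness.
Context {R : realType}.

Lemma bounded_set_le (X : normedModType R) (B : set X) : bounded_set B ->
  exists C, 0 < C /\ forall x, B x -> `|x| <= C.
Proof.
by move=> /ex_strict_bound_gt0[C C0 BC]; exists C; split=> // x /BC /ltW.
Qed.

(** The point [q] ranges over the whole space, so that the values of a limit can be compared
    directly with those of functions in [K]. *)
Lemma compact_uniform_continuity (X Y : normedModType R) (K : set X)
    (g : X -> Y) (eps : R) : compact K -> continuous g -> 0 < eps ->
  exists d, 0 < d /\ forall p q, K p -> `|p - q| <= d -> `|g p - g q| <= eps.
Proof.
move=> /compact_near_coveringP cK gc eps0.
have := cK _ (0 : R)^'+ (fun d p => forall q, `|p - q| <= d -> `|g p - g q| <= eps).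
move=> /(_ _)/(_ _)[|].
  move=> x Kx; have e20 : 0 < eps / 2 by rewrite divr_gt0.
  have /cvgrPdist_le /(_ _ e20) := gc x.
  move=> /nbhs_normP[eta /= eta0 xeta].
  exists (ball x (eta / 2), [set d | d < eta / 2]) => /=.
    split; first by apply: nbhsx_ballx; rewrite divr_gt0.
    by apply: nbhs_right_lt; rewrite divr_gt0.
  move=> [p d] /= [xp dd] q pq.
  have xp' : `|g x - g p| <= eps / 2.
    apply: xeta => /=; move: xp; rewrite -ball_normE /= => /lt_trans; apply.
    by rewrite ltr_pdivrMr// ltr_pMr// ltr1n.
  have xq' : `|g x - g q| <= eps / 2.
    apply: xeta => /=; rewrite -(subrKA p) (le_lt_trans (ler_normD _ _))//.
    rewrite (splitr eta) ltrD//; last exact: le_lt_trans dd.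
    by move: xp; rewrite -ball_normE.
  rewrite -(subrKA (g x)) (le_trans (ler_normD _ _))// (splitr eps) lerD//.
  by rewrite distrC.
move=> d /= d0 H; exists (d / 2); split; first by rewrite divr_gt0.
move=> p q Kp pq; apply: (H (d / 2)) => //=.
  rewrite sub0r normrN gtr0_norm ?divr_gt0//.
  by rewrite ltr_pdivrMr// ltr_pMr// ltr1n.
by rewrite divr_gt0.
Qed.

End compactness.

Section semigroup.
Context {R : realType} {X : completeNormedModType R} (T : R -> {linear X -> X}).
Hypothesis hT : C0_semigroup T.

Lemma semigroup_right0 (x : X) (eps : R) : 0 < eps ->
  exists d, 0 < d /\ forall t, 0 <= t -> t < d -> `|T t x - x| <= eps.
Proof.
move=> eps0; have [_ T0 _ /(_ x) Tx] := hT.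
have /cvgrPdist_le /(_ _ eps0) [d /= d0 H] := Tx.
exists d; split=> // t; rewrite le_eqVlt => /predU1P[<- _|t0 td].
  by rewrite T0 subrr normr0 ltW.
by rewrite distrC; apply: H => //=; rewrite sub0r normrN gtr0_norm.
Qed.

(** Otherwise there are times tending to 0 along which the operator norms blow up, although strong
    continuity makes the operators pointwise bounded; this contradicts Banach-Steinhaus. *)
Lemma semigroup_bound0 : exists d M : R, [/\ 0 < d, 0 < M &
  forall t x, 0 <= t -> t < d -> `|T t x| <= M * `|x| ].
Proof.
apply: contrapT => nb.
have /choice[p pP] (n : nat) : exists p : R * X,
    [/\ 0 <= p.1, p.1 < n.+1%:R^-1 & n.+1%:R * `|p.2| < `|T p.1 p.2| ].
  apply: contrapT => np; apply: nb; exists n.+1%:R^-1, n.+1%:R.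
  split; [by rewrite invr_gt0 ltr0n|by rewrite ltr0n|move=> t x t0 tn].
  by rewrite leNgt; apply/negP => h; apply: np; exists (t, x).
have UB : uniform_bounded [set (T (p n).1 : X -> X) | n in [set: nat]].
  apply: Banach_Steinhauss.
- move=> _ [n _ <-]; split; last exact: linearP.
  have Tc : continuous (T (p n).1) by have [c _ _ _] := hT; apply: c; case: (pP n).
  exact/bounded_funP/linear_bounded_continuous.
- move=> x; have : (fun n => T (p n).1 x) @ \oo --> x.
    apply/cvgrPdist_le => eps eps0.
    have [d [d0 H]] := semigroup_right0 x eps0.
    near=> n; rewrite distrC; have [pn0 pn _] := pP n.
    apply: H => //; apply: (lt_le_trans pn); rewrite -[leRHS]invrK.
    rewrite lef_pV2 ?posrE ?invr_gt0 ?ltr0n//.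
    apply: (le_trans (ltW (truncnS_gt _))); rewrite ler_nat ltnS ltnW//.
    by near: n; exists (Num.trunc d^-1).+1.
  move=> /cvgP/cvg_seq_bounded/ex_strict_bound_gt0[M _ MP].
  by exists M => _ [n _ <-]; apply: ltW; exact: MP.
have [M MP] := UB 1.
have [n Mn] : exists n : nat, M < n.+1%:R.
  by exists (Num.trunc M); exact: truncnS_gt.
have [_ _ hn] := pP n.
have x0 : 0 < `|(p n).2|.
  rewrite normr_gt0; apply/eqP => p0; move: hn.
  by rewrite p0 linear0 normr0 mulr0 ltxx.
have := MP _ (ex_intro2 _ _ n I erefl) (`|(p n).2|^-1 *: (p n).2).
rewrite normrZ normfV normr_id mulVf ?gt_eqF// lexx => /(_ isT).
rewrite linearZ normrZ normfV normr_id ler_pdivrMl// => /(lt_le_trans hn).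
by rewrite mulrC ltr_pM2l// ltNge (ltW Mn).
Unshelve. all: by end_near. Qed.

(** The local bound is iterated in steps of [d / 2], since it holds for times strictly below [d].
    Replacing [M] by [max M 1] makes its powers nondecreasing, so a single exponent covers
    [[0, a]]. *)
Lemma semigroup_bound (a : R) : exists M : R, 0 < M /\
  forall t x, 0 <= t -> t <= a -> `|T t x| <= M * `|x|.
Proof.
have [d [M [d0 M0 H]]] := semigroup_bound0.
have [_ T0 TD _] := hT.
pose M1 := Num.max M 1.
have M10 : 0 < M1 by rewrite lt_max M0.
have M11 : 1 <= M1 by rewrite le_max lexx orbT.
have Hn n : forall t x, 0 <= t -> t <= n%:R * (d / 2) -> `|T t x| <= M1 ^+ n * `|x|.
  elim: n => [|n IH] t x t0 tn.
    have -> : t = 0 by apply/le_anti; rewrite t0 andbT; move: tn; rewrite mul0r.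
    by rewrite T0 expr0 mul1r.
  have [tl|tl] := leP t (n%:R * (d / 2)).
    apply: (le_trans (IH t x t0 tl)); rewrite ler_wpM2r// exprS.
    by rewrite ler_peMl// exprn_ge0// ltW.
  have d20 : 0 < d / 2 by rewrite divr_gt0.
  have nd : 0 <= n%:R * (d / 2) by rewrite mulr_ge0// ltW.
  have td : t - n%:R * (d / 2) < d.
    rewrite ltrBlDl; apply: (le_lt_trans tn).
    by rewrite -natr1 mulrDl mul1r ltrD2l ltr_pdivrMr// ltr_pMr// ltr1n.
  rewrite -[X in T X](subrK (n%:R * (d / 2))) TD//; last first.
    by rewrite subr_ge0 ltW.
  apply: (@le_trans _ _ (M1 * `|T (n%:R * (d / 2)) x|)).
    apply: (le_trans (H _ _ _ td)); first by rewrite subr_ge0 ltW.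
    by rewrite ler_wpM2r// le_max lexx.
  by rewrite exprS -mulrA ler_wpM2l ?(ltW M10)//; exact: IH.
exists (M1 ^+ (Num.trunc (a / (d / 2))).+1); split; first exact: exprn_gt0.
move=> t x t0 ta; apply: Hn => //; apply: (le_trans ta).
by rewrite -ler_pdivrMr ?divr_gt0// ltW// truncnS_gt.
Qed.

(** Continuity of one orbit at time 0 spreads to a ball of initial values by the local bound [M];
    compactness makes the time uniform over [K]. *)
Lemma semigroup_compact_right0 (K : set X) (eps : R) : compact K -> 0 < eps ->
  exists d, 0 < d /\
    forall t x, 0 <= t -> t < d -> K x -> `|T t x - x| <= eps.
Proof.
move=> /compact_near_coveringP cK eps0.
have [d [M [d0 M0 HM]]] := semigroup_bound0.
have := cK _ (0 : R)^'+ (fun h p => forall t, 0 <= t -> t < h -> `|T t p - p| <= eps).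
move=> /(_ _)/(_ _)[|].
  move=> x Kx; have e20 : 0 < eps / 2 by rewrite divr_gt0.
  have [e [e0 He]] := semigroup_right0 x e20.
  (* Chosen with [(M + 1) * r = eps / 2], which absorbs [T t (p - x)] and [x - p] together. *)
  pose r := eps / 2 / (M + 1).
  have M10 : 0 < M + 1 by rewrite addr_gt0.
  have r0 : 0 < r by rewrite divr_gt0.
  exists (ball x r, [set h | h < Num.min d e]) => /=.
    split; first exact: nbhsx_ballx.
    by apply: nbhs_right_lt; rewrite lt_min d0.
  move=> [p h] /= [xp hh] t t0 th.
  have td : t < d by apply: (lt_trans th); apply: (lt_le_trans hh); rewrite ge_min lexx.
  have te : t < e.
    by apply: (lt_trans th); apply: (lt_le_trans hh); rewrite ge_min lexx orbT.
  have -> : T t p - p = T t (p - x) + (x - p) + (T t x - x).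
    by rewrite linearB/= addrAC !subrKA.
  rewrite (le_trans (ler_normD _ _))// (splitr eps) lerD//; last exact: He.
  have px : `|x - p| <= r by move: xp; rewrite -ball_normE => /ltW.
  rewrite (le_trans (ler_normD _ _))//.
  apply: (@le_trans _ _ (M * r + r)).
    by rewrite lerD// (le_trans (HM _ _ t0 td))// ler_wpM2l ?(ltW M0)// distrC.
  by rewrite -[X in _ + X]mul1r -mulrDl /r mulrC divfK// gt_eqF.
move=> e /= e0 H; exists (e / 2); split; first by rewrite divr_gt0.
move=> t x t0 te Kx; apply: (H (e / 2)) => //=.
  rewrite sub0r normrN gtr0_norm ?divr_gt0//.
  by rewrite ltr_pdivrMr// ltr_pMr// ltr1n.
by rewrite divr_gt0.
Qed.

End semigroup.

(** * Local L1 convergence and almost automorphy *)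

(** Stated with [upint], so that errors can be added and intervals glued without measurability of
    [w]. *)
Definition L1loc_cvg0 (R : realType) (w : nat -> R -> R) : Prop :=
  forall a b eps : R, 0 < eps ->
    \forall n \near \oo, upint `[a, b] (w n) eps%:E.

Section L1loc.
Context {R : realType}.
Local Notation mu := (@lebesgue_measure R).

Lemma increasing_cvg_infty (k : nat -> nat) :
  {homo k : m n / (m < n)%N >-> (m < n)%N} -> k @ \oo --> \oo.
Proof.
move=> hk; have kn n : (n <= k n)%N.
  by elim: n => // n IH; apply: (leq_ltn_trans IH); exact: hk.
by move=> P [N _ NP]; exists N => // n /= Nn; apply: NP => /=; apply: leq_trans (kn n).
Qed.

Lemma L1loc_cvg0_sub (w : nat -> R -> R) (k : nat -> nat) :
  {homo k : m n / (m < n)%N >-> (m < n)%N} ->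
  L1loc_cvg0 w -> L1loc_cvg0 (fun n => w (k n)).
Proof.
move=> /increasing_cvg_infty hk hw a b eps eps0.
exact: hk (hw a b eps eps0).
Qed.

Lemma L1loc_cvg0_unit (w : nat -> R -> R) :
  (forall t eps, 0 < eps -> \forall n \near \oo, upint `[t, t + 1] (w n) eps%:E) ->
  L1loc_cvg0 w.
Proof.
move=> hw a b eps eps0.
have H (N : nat) : forall e : R, 0 < e ->
    \forall n \near \oo, upint `[a, a + N.+1%:R] (w n) e%:E.
  elim: N => [|N IH] e e0; first exact: hw.
  have e20 : 0 < e / 2 by rewrite divr_gt0.
  apply: filterS2 (IH _ e20) (hw (a + N.+1%:R) _ e20) => n h1 h2.
  have -> : (e%:E = (e / 2)%:E + (e / 2)%:E)%E by rewrite -EFinD -splitr.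
  rewrite (_ : `[a, a + N.+2%:R]%classic =
      `[a, a + N.+1%:R]%classic `|` `[a + N.+1%:R, a + N.+1%:R + 1]%classic).
    exact: upintU.
  rewrite -[N.+2%:R]natr1 addrA; apply/seteqP; split=> r /=; rewrite !in_itv /=.
    move=> /andP[-> ->]; have [|/ltW ->] := leP r (a + N.+1%:R); first by left.
    by right.
  have aN : a <= a + N.+1%:R by rewrite lerDl.
  case=> /andP[h h']; first by rewrite h (le_trans h')// lerDl.
  by rewrite h' (le_trans aN h).
have [N bN] : exists N : nat, b - a < N.+1%:R.
  by exists (Num.trunc (b - a)); exact: truncnS_gt.
apply: filterS (H N _ eps0) => n; apply: upintS => // r /=.
rewrite !in_itv /= => /andP[-> rb] /=; apply: (le_trans rb).
by rewrite -lerBlDl ltW.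
Qed.

Section vector.
Context {Y : normedModType R}.
Implicit Types u v : R -> Y.

Lemma L1_loc_upint u a b : L1_loc u ->
  exists c : R, upint `[a, b] (fun r => `|u r|) c%:E.
Proof.
move=> [um ui]; exists (fine (\int[mu]_(r in `[a, b]) `|u r|%:E)%E).
have um' : strongly_measurable `[a, b] u by exact: strongly_measurableS um.
apply: upint_le (strongly_measurable_upint _ um') => //; first by apply: aeW.
rewrite fineK// ge0_fin_numE//.
by apply: integral_ge0 => r _; rewrite lee_fin.
Qed.

Lemma cvg0_upint (u : nat -> R -> Y) (D : set R) (eps : R) : measurable D ->
  (forall n, strongly_measurable setT (u n)) ->
  (fun n => \int[mu]_(r in D) `|u n r|%:E)%E @ \oo --> 0%E -> 0 < eps ->
  \forall n \near \oo, upint D (fun r => `|u n r|) eps%:E.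
Proof.
move=> mD um u0 eps0; apply: filterS (cvge0_le u0 eps0) => n un.
have um' : strongly_measurable D (u n) by apply: strongly_measurableS (um n).
by apply: upint_le (strongly_measurable_upint mD um') => //; apply: aeW.
Qed.

Lemma AAS1_subsequence u (s' : nat -> R) : AAS1 u ->
  exists (k : nat -> nat) v,
    [/\ {homo k : m n / (m < n)%N >-> (m < n)%N}, L1_loc v,
        L1loc_cvg0 (fun n r => `|u (r + s' (k n)) - v r|) &
        L1loc_cvg0 (fun n r => `|v (r - s' (k n)) - u r|)].
Proof.
move=> [[um _] /(_ s')[k [v [hk lv H]]]]; exists k, v; split=> //.
- apply: L1loc_cvg0_unit => t eps eps0.
  apply: (@cvg0_upint (fun n r => u (r + s' (k n)) - v r)) => //; last first.
    by case: (H t).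
  move=> n; apply: strongly_measurableB; last by case: lv.
  exact: strongly_measurable_shift.
- apply: L1loc_cvg0_unit => t eps eps0.
  apply: (@cvg0_upint (fun n r => v (r - s' (k n)) - u r)) => //; last first.
    by case: (H t).
  move=> n; apply: strongly_measurableB => //.
  by apply: strongly_measurable_shift; case: lv.
Qed.

(** Absolute continuity of the integral, applied to the majorant cut off to [[0, 1]]. *)
Lemma upint_small (f : R -> R) (c eps : R) : upint `[0, 1] f c%:E -> 0 < eps ->
  exists d, [/\ 0 < d, d <= 1 & upint `[0, d] f eps%:E].
Proof.
move=> [h [mh h0 fh hc]] eps0.
have m01 : measurable (`[0, 1]%classic : set R) by [].
have ih : mu.-integrable `[0, 1] h.
  apply/integrableP; split; first exact: measurable_funTS.
  have -> : (\int[mu]_(r in `[0%R, 1%R]) `|h r| = \int[mu]_(r in `[0%R, 1%R]) h r)%E.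
    by apply: eq_integral => r _; rewrite gee0_abs.
  by apply: le_lt_trans hc _; exact: ltry.
(* [fine] makes the majorant real-valued; it alters [h] on a null subset of [[0, 1]], where [h] is
   infinite. *)
pose F := (fine \o h) \_ `[0, 1].
have mF : measurable_fun [set: R] F.
  apply/(measurable_restrictT _ _).1 => //.
  by apply: measurable_funTS; exact: measurableT_comp.
have aefin : {ae mu, forall r, `[0%R, 1%R]%classic r -> h r \is a fin_num}.
  by apply: integrable_ae; [exact: m01|exact: ih].
have iF : mu.-integrable setT (EFin \o F).
  apply/integrableP; split; first exact/measurable_EFinP.
  have F0 r : 0 <= F r by rewrite /F /patch; case: ifP => //= _; exact: fine_ge0.
  apply: (@le_lt_trans _ _ c%:E); last exact: ltry.
  have -> : (\int[mu]_x `|(EFin \o F) x| = \int[mu]_(r in setT) (F r)%:E)%E.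
    by apply: eq_integral => r _; rewrite gee0_abs// lee_fin.
  apply: upint_integral => //; exists (h \_ `[0, 1]); split.
  - by apply/(measurable_restrictT _ _).1 => //; exact: measurable_funTS.
  - by move=> r; rewrite /patch; case: ifP.
  - apply: filterS aefin => r fr _; rewrite /F /patch; case: ifPn => //.
    by rewrite inE => /fr /fineK /= ->.
  - by rewrite -integral_mkcond.
have [d [d0 H]] := integral_normr_continuous iF eps0.
(* Halving keeps the length strictly below [d]; the cap keeps the interval inside [[0, 1]]. *)
exists (Num.min (d / 2) 1); split.
- by rewrite lt_min divr_gt0//=.
- by rewrite ge_min lexx orbT.
have sub : `[0%R, Num.min (d / 2) 1]%classic `<=` `[0, 1]%classic.
  move=> r /=; rewrite !in_itv /= => /andP[-> rd] /=; apply: (le_trans rd).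
  by rewrite ge_min lexx orbT.
have mud : (mu `[0%R, (Num.min (d / 2) 1)%R]%classic < d%:E)%E.
  rewrite lebesgue_measure_itv /=; case: ifP => _; last by rewrite lte_fin.
  rewrite -EFinB subr0 lte_fin gt_min; apply/orP; left.
  by rewrite ltr_pdivrMr// ltr_pMr// ltr1n.
have Hd := H _ (measurable_itv _) mud.
exists (EFin \o (fun r => `|F r|)); split.
- by apply/measurable_EFinP; exact: measurableT_comp.
- by move=> r; rewrite lee_fin.
- apply: filterS2 fh aefin => r fh fr rd; have r01 := sub _ rd.
  rewrite /= /F /patch mem_set//= ger0_norm ?fine_ge0//.
  by rewrite fineK ?fr//; exact: fh.
- have iFd : mu.-integrable `[0, Num.min (d / 2) 1] (EFin \o (fun r => `|F r|)).
    have iF' : mu.-integrable setT (EFin \o (fun r => `|F r|)).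
      exact: (integrable_abse iF).
    exact: integrableS iF'.
  rewrite -[leLHS]fineK; first by rewrite lee_fin ltW.
  exact: integrable_fin_num.
Qed.

(** If it fails on ever shorter intervals, translate their left ends to 0. A subsequence of the
    translates of [u] converges in L^1 on [[0, 1]] to one integrable [v], whose integral over
    [[0, d]] is small: a contradiction. *)
Lemma AAS1_uniformly_integrable u (eps : R) : AAS1 u -> 0 < eps ->
  exists d, 0 < d /\ forall a b, b <= a + d ->
    upint `[a, b] (fun r => `|u r|) eps%:E.
Proof.
move=> uA eps0; apply: contrapT => nd.
have /choice[p pP] (n : nat) : exists p : R * R, p.2 <= p.1 + n.+1%:R^-1 /\
    ~ upint `[p.1, p.2] (fun r => `|u r|) eps%:E.
  apply: contrapT => np; apply: nd; exists n.+1%:R^-1.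
  split=> [|a b ab]; first by rewrite invr_gt0 ltr0n.
  by apply: contrapT => nu; apply: np; exists (a, b).
have [k [v [hk lv Huv _]]] := AAS1_subsequence (fun n => (p n).1) uA.
have [c hc] := L1_loc_upint 0 1 lv.
have e20 : 0 < eps / 2 by rewrite divr_gt0.
have [d [d0 d1 hd]] := upint_small hc e20.
have HN : \forall n \near \oo, n.+1%:R^-1 <= d.
  near=> n; rewrite -[leRHS]invrK lef_pV2 ?posrE ?invr_gt0 ?ltr0n//.
  apply: (le_trans (ltW (truncnS_gt _))); rewrite ler_nat ltnS ltnW//.
  by near: n; exists (Num.trunc d^-1).+1.
have HN' : \forall n \near \oo, (k n).+1%:R^-1 <= d.
  exact: increasing_cvg_infty hk _ HN.
have [m [hm1 hm2]] := filter_ex (filterI HN' (Huv 0 1 _ e20)).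
have [pb] := pP (k m); apply.
have sum : upint `[0, d] (fun r => `|u (r + (p (k m)).1)|) eps%:E.
  have -> : (eps%:E = (eps / 2)%:E + (eps / 2)%:E)%E by rewrite -EFinD -splitr.
  have hm3 : upint `[0, d] (fun r => `|u (r + (p (k m)).1) - v r|) (eps / 2)%:E.
    apply: upintS hm2 => // r /=; rewrite !in_itv /= => /andP[-> rd] /=.
    exact: le_trans d1.
  apply: upint_le (upintD _ hm3 hd) => //.
  by apply: aeW => r _ /=; rewrite -{1}[u (r + _)](subrK (v r)) ler_normD.
have := @upint_shift _ (- (p (k m)).1) _ _ _ _ sum.
under [X in upint _ X]eq_fun do rewrite subrK.
move=> /(_ (measurable_itv _)); apply: upintS => //.
  suff -> : ((fun r => r - (p (k m)).1) @^-1` `[0, d]) =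
    `[(p (k m)).1, (p (k m)).1 + d]%classic by [].
  by apply/seteqP; split=> r /=; rewrite !in_itv /= subr_ge0 lerBlDl.
move=> r /=; rewrite !in_itv /= subr_ge0 => /andP[-> rp] /=.
rewrite lerBlDl (le_trans rp)// (le_trans pb)//.
by rewrite lerD2l.
Unshelve. all: by end_near. Qed.

End vector.
End L1loc.

(** * Ascoli *)

Definition locally_uniform_cvg (R : realType) (X : normedModType R)
    (xs : nat -> R -> X) (y : R -> X) : Prop :=
  forall a eps : R, 0 < eps ->
    \forall n \near \oo, forall t, `|t| <= a -> `|xs n t - y t| <= eps.

(** Over [unit] this is uniform continuity of a single function. The order [s <= t] matches the mild
    formula, which runs forward in time. *)
Definition uniformly_equicontinuous (R : realType) (X : normedModType R) (I : Type)
    (xs : I -> R -> X) : Prop :=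
  forall eps : R, 0 < eps -> exists d, 0 < d /\
    forall i s t, s <= t -> t <= s + d -> `|xs i t - xs i s| <= eps.

Section ascoli.
Context {R : realType} {X : normedModType R}.
Implicit Types (xs : nat -> R -> X) (y : R -> X).

Lemma locally_uniform_cvg_family xs y : locally_uniform_cvg xs y ->
  {family compact, xs @ \oo --> y}.
Proof.
move=> cv; apply/fam_cvgP => A cA P /uniform_nbhs[E [entE EP]].
have [e /= e0 eE] : exists2 e : R, 0 < e & [set xy | ball xy.1 e xy.2] `<=` E.
  by move: entE; rewrite -entourage_ballE => -[e /= e0 eE]; exists e.
have [a [_ Aa]] := bounded_set_le (compact_bounded cA).
have e20 : 0 < e / 2 by rewrite divr_gt0.
apply: filterS (cv a _ e20) => n H; apply: EP => t At.
apply: eE => /=; rewrite -ball_normE /= distrC.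
apply: (le_lt_trans (H t (Aa _ At))).
by rewrite ltr_pdivrMr// ltr_pMr// ltr1n.
Qed.

Lemma uniformly_equicontinuous_continuous y :
  uniformly_equicontinuous (fun _ : unit => y) -> continuous y.
Proof.
move=> ey t; apply/cvgrPdist_le => eps eps0.
have [d [d0 H]] := ey _ eps0.
apply/nbhs_normP; exists d => //= s /= st.
have /andP[h1 h2] : (t - d <= s) && (s <= t + d) by rewrite -ler_distlC ltW.
have [ts|/ltW ts] := leP t s; first by rewrite distrC; exact: (H tt).
by apply: (H tt) => //; rewrite -lerBlDr.
Qed.

Lemma extract_subsequence (P : nat -> nat -> Prop) :
  (forall n N, exists m, (N <= m)%N /\ P n m) ->
  exists k : nat -> nat,
    {homo k : m n / (m < n)%N >-> (m < n)%N} /\ forall n, P n (k n).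
Proof.
move=> H; have /choice[f fP] (p : nat * nat) : exists m, (p.2 <= m)%N /\ P p.1 m.
  exact: H.
pose k := fix k n := if n is n'.+1 then f (n, (k n').+1) else f (0%N, 0%N).
exists k; split; last first.
  by case=> [|n]; [case: (fP (0, 0)%N)|case: (fP (n.+1, (k n).+1))].
apply: (@homo_ltn _ k (fun m n => (m < n)%N)) => [b a c|n]; first exact: ltn_trans.
by have [] := fP (n.+1, (k n).+1).
Qed.

Lemma filter_seq (I : eqType) (U : Type) (F : set_system U) (P : I -> set U)
    (s : seq I) : Filter F -> (forall i, F (P i)) ->
  F [set f | forall i, i \in s -> P i f].
Proof.
move=> FF FP; elim: s => [|i s IH]; first exact: (filterS _ filterT).
apply: filterS2 (FP i) IH => f fi fs j.
by rewrite in_cons => /predU1P[->|]; last exact: fs.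
Qed.

(** Tychonoff yields a cluster point [y] for pointwise convergence, but no subsequence.
    Equicontinuity passes to [y] and upgrades closeness on a finite grid to uniform closeness on
    [[-a, a]]; only then is a subsequence extracted. *)
Lemma ascoli (K : set X) xs : compact K -> (forall n t, K (xs n t)) ->
  uniformly_equicontinuous xs ->
  exists (k : nat -> nat) y,
    [/\ {homo k : m n / (m < n)%N >-> (m < n)%N},
        locally_uniform_cvg (fun n => xs (k n)) y,
        forall t, K (y t) & uniformly_equicontinuous (fun _ : unit => y)].
Proof.
move=> cK xK ex.
have cKK := @tychonoff R (fun=> X) (fun=> K) (fun=> cK).
have xF : (xs @ \oo) [set f | forall t, K (f t)] by exists 0%N => // n _; exact: xK.
have [y [Ky cly]] := cKK (xs @ \oo) _ xF.
have claim (s : seq R) (eps : R) N : 0 < eps ->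
    exists m, (N <= m)%N /\ forall q, q \in s -> `|xs m q - y q| <= eps.
  move=> eps0.
  have nB : nbhs (y : prod_topology (fun _ : R => X))
      [set f | forall q, q \in s -> `|f q - y q| <= eps].
    have nB1 q : nbhs (y : prod_topology (fun _ : R => X))
        [set f | `|f q - y q| <= eps].
      have H : \forall z \near y q, `|z - y q| <= eps.
        by apply: cvgr_distC_le => //; exact: cvg_id.
      exact: (@proj_continuous R (fun=> X) q y _ H).
    have FF : Filter (nbhs (y : prod_topology (fun _ : R => X))) by exact: nbhs_filter.
    exact: (filter_seq s FF nB1).
  have nA : (xs @ \oo) [set f | exists m, (N <= m)%N /\ f = xs m].
    by exists N => // m /= Nm; exists m.
  by have [_ [[m [Nm ->]] H]] := cly _ _ nA nB; exists m.
have ey : uniformly_equicontinuous (fun _ : unit => y).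
  move=> eps eps0; have [d [d0 H]] := ex _ eps0; exists d; split=> // _ s t st ts.
  apply/ler_addgt0Pr => e e0.
  have e20 : 0 < e / 2 by rewrite divr_gt0.
  have [m [_ Hm]] := claim [:: s; t] (e / 2) 0%N e20.
  have -> : y t - y s = (xs m t - xs m s) + ((xs m s - y s) - (xs m t - y t)).
    by rewrite opprB addrA subrKA addrC subrKA.
  rewrite (le_trans (ler_normD _ _))// lerD//; first exact: H.
  rewrite (le_trans (ler_normB _ _))// (splitr e) lerD// Hm// !inE eqxx ?orbT//.
have unif (a eps : R) N : 0 < eps ->
    exists m, (N <= m)%N /\ forall t, `|t| <= a -> `|xs m t - y t| <= eps.
  move=> eps0; have e30 : 0 < eps / 3 by rewrite divr_gt0.
  have [d1 [d10 H1]] := ex _ e30; have [d2 [d20 H2]] := ey _ e30.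
  pose d := Num.min d1 d2.
  have d0 : 0 < d by rewrite lt_min d10.
  (* Grid of mesh [d] starting at [-a]; with last index the integer part of [2 * a / d], every [t]
     with [|t| <= a] has a grid point at most [d] to its left. *)
  pose g i : R := - a + i%:R * d.
  have [m [Nm Hm]] := claim [seq g i | i <- iota 0 (Num.trunc (2 * a / d)).+1] _ N e30.
  exists m; split=> // t; rewrite ler_norml => /andP[ta at'].
  pose i := Num.trunc ((t + a) / d).
  have ta0 : 0 <= (t + a) / d by rewrite divr_ge0 ?(ltW d0)// -lerBlDr sub0r.
  have gt : g i <= t.
    by rewrite /g addrC lerBlDr -ler_pdivlMr// truncn_le.
  have tg : t <= g i + d.
    rewrite /g -addrA -lerBlDl opprK -[X in _ <= _ + X]mul1r -mulrDl natr1.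
    by rewrite -ler_pdivrMr// ltW// truncnS_gt.
  have gs : g i \in [seq g i | i <- iota 0 (Num.trunc (2 * a / d)).+1].
    apply: map_f; rewrite mem_iota /= add0n ltnS /i.
    apply: le_truncn; rewrite ler_pM2r ?invr_gt0// mulr_natl mulr2n.
    by rewrite lerD2r.
  have -> : xs m t - y t = (xs m t - xs m (g i)) + (xs m (g i) - y (g i))
      + (y (g i) - y t) by rewrite !subrKA.
  have -> : eps = eps / 3 + eps / 3 + eps / 3 by lra.
  rewrite (le_trans (ler_normD _ _))// lerD//.
    rewrite (le_trans (ler_normD _ _))// lerD//; last exact: Hm.
    by apply: H1 => //; apply: (le_trans tg); rewrite lerD2l ge_min lexx.
  rewrite distrC; apply: (H2 tt) => //.
  by apply: (le_trans tg); rewrite lerD2l ge_min lexx orbT.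
have pn n : 0 < (n.+1%:R^-1 : R) by rewrite invr_gt0 ltr0n.
have [k [hk Hk]] := @extract_subsequence
  (fun n m => forall t, `|t| <= n%:R -> `|xs m t - y t| <= n.+1%:R^-1)
  (fun n N => unif n%:R _ N (pn n)).
exists k, y; split=> // a eps eps0.
near=> n => t ta; apply: (le_trans (Hk n t _)).
  apply: (le_trans ta); apply: (le_trans (ltW (truncnS_gt _))); rewrite ler_nat.
  by near: n; exists (Num.trunc a).+1.
rewrite -[leRHS]invrK lef_pV2 ?posrE ?invr_gt0 ?ltr0n//.
apply: (le_trans (ltW (truncnS_gt _))); rewrite ler_nat ltnS ltnW//.
by near: n; exists (Num.trunc eps^-1).+1.
Unshelve. all: by end_near. Qed.

End ascoli.

(** * Mild solutions *)

(** The coefficients are explicit because translates and hull equations change them; a single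
    interval is used because a translated half-line solution satisfies the formula only on some
    intervals. *)
Definition mild_on (R : realType) (X : completeNormedModType R)
    (T : R -> {linear X -> X}) (g : X -> X) (phi : R -> R) (psi : R -> X)
    (x : R -> X) (a b : R) : Prop :=
  is_bochner_integral `[a, b] (fun s => T (b - s) (phi s *: g (x s) + psi s))
    (x b - T (b - a) (x a)).

Section mild.
Context {R : realType} {X : completeNormedModType R} (T : R -> {linear X -> X}).
Hypothesis hT : C0_semigroup T.
Variable g : X -> X.
Hypothesis hg : continuous g.
Local Notation mu := (@lebesgue_measure R).
Implicit Types (phi : R -> R) (psi : R -> X) (x y : R -> X).

Lemma lebesgue_measure_itvcc_lty (a b : R) : (mu `[a, b]%classic < +oo)%E.
Proof. by rewrite lebesgue_measure_itv /=; case: ifP => _; rewrite ?ltry. Qed.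

Lemma mild_on_shift phi psi x (s a b : R) : mild_on T g phi psi x (a + s) (b + s) ->
  mild_on T g (fun r => phi (r + s)) (fun r => psi (r + s)) (fun r => x (r + s)) a b.
Proof.
move=> /(@bochner_shift _ _ s) => /(_ (measurable_itv _)); rewrite /mild_on.
have -> : (fun r => r + s) @^-1` `[a + s, b + s] = `[a, b]%classic.
  by apply/seteqP; split=> r /=; rewrite !in_itv /= !lerD2r.
have E c d : c + s - (d + s) = c - d by rewrite opprD addrACA subrr addr0.
rewrite E; congr is_bochner_integral; apply/funext => r /=; by rewrite E.
Qed.

Lemma mild_on_norm phi psi x (a b h C e1 e2 : R) : a <= b -> b <= a + 1 ->
  mild_on T g phi psi x a b -> (forall t, a <= t -> t <= b -> `|g (x t)| <= C) ->
  0 <= C -> (forall t z, 0 <= t -> t <= 1 -> `|T t z| <= h * `|z|) -> 0 <= h ->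
  upint `[a, b] (fun r => `|phi r|) e1%:E ->
  upint `[a, b] (fun r => `|psi r|) e2%:E ->
  `|x b - T (b - a) (x a)| <= h * (C * e1 + e2).
Proof.
move=> ab ba m gC C0 Th h0 u1 u2; rewrite -lee_fin.
apply: (bochner_norm _ (lebesgue_measure_itvcc_lty a b) m) => //.
rewrite EFinM EFinD EFinM.
apply: upint_le (upintZ _ h0 (upintD _ (upintZ _ C0 u1) u2)) => //.
apply: aeW => r /=; rewrite in_itv /= => /andP[ar rb].
apply: (le_trans (Th _ _ _ _)); first by rewrite subr_ge0.
  by rewrite lerBlDr (le_trans ba)// addrC lerD2l.
rewrite ler_wpM2l// (le_trans (ler_normD _ _))// lerD2r normrZ mulrC.
by rewrite ler_wpM2r// gC.
Qed.

(* The semigroup term is uniformly small on the compact set [K] and the integral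
   term is small by uniform integrability, so the modulus depends on [K] only. *)
Lemma mild_on_equicontinuous (K : set X) phi psi (C : R) (I : Type)
    (xs : I -> R -> X) : compact K -> 0 <= C -> (forall p, K p -> `|g p| <= C) ->
  (forall eps, 0 < eps -> exists d, 0 < d /\ forall a b, b <= a + d ->
    upint `[a, b] (fun r => `|phi r|) eps%:E) ->
  (forall eps, 0 < eps -> exists d, 0 < d /\ forall a b, b <= a + d ->
    upint `[a, b] (fun r => `|psi r|) eps%:E) ->
  forall eps, 0 < eps -> exists d, 0 < d /\ forall i a b, a <= b -> b <= a + d ->
    (forall t, a <= t -> t <= b -> K (xs i t)) ->
    mild_on T g phi psi (xs i) a b -> `|xs i b - xs i a| <= eps.
Proof.
move=> cK C0 gC uphi upsi eps eps0.
have [h [h0 Hh]] := semigroup_bound hT 1.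
have e20 : 0 < eps / 2 by rewrite divr_gt0.
have [d1 [d10 H1]] := semigroup_compact_right0 hT cK e20.
(* Solves [h * (C * e1 + e1) = eps / 2], the bound of [mild_on_norm]. *)
pose e1 := eps / 2 / (h * (C + 1)).
have hC : 0 < h * (C + 1) by rewrite mulr_gt0// ltr_wpDl.
have e10 : 0 < e1 by rewrite divr_gt0.
have [d2 [d20 H2]] := uphi _ e10.
have [d3 [d30 H3]] := upsi _ e10.
(* [d1] is halved because its estimate concerns strictly smaller times; the cap 1 is the range of
   the bound [h]. *)
pose d := Num.min (Num.min (d1 / 2) 1) (Num.min d2 d3).
exists d; split; first by rewrite !lt_min d20 d30 divr_gt0//= ltr01.
move=> i a b ab bd xK m.
have ba e : d <= e -> b <= a + e by move=> de; rewrite (le_trans bd)// lerD2l.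
have [dd1 dd2 dd3] : [/\ d <= 1, d <= d2 & d <= d3].
  by split; rewrite /d !ge_min ?lexx ?orbT.
have B := mild_on_norm ab (ba _ dd1) m (fun t ta tb => gC _ (xK t ta tb)) C0 Hh
  (ltW h0) (H2 _ _ (ba _ dd2)) (H3 _ _ (ba _ dd3)).
rewrite -(subrKA (T (b - a) (xs i a))) (le_trans (ler_normD _ _))//.
rewrite [leRHS]splitr lerD//.
  apply: (le_trans B); rewrite -[X in _ + X]mul1r -mulrDl mulrA.
  by rewrite /e1 mulrC divfK// gt_eqF.
apply: H1; [by rewrite subr_ge0| |by apply: xK].
rewrite ltrBlDl (le_lt_trans (ba (d1 / 2) _))//.
  by rewrite /d !ge_min lexx.
by rewrite ltrD2l ltr_pdivrMr// ltr_pMr// ltr1n.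
Qed.

(** The difference of the integrands splits into [(phis n - phi) *: g (xs n)],
    [phi *: (g (xs n) - g y)] and [psis n - psi]. Boundedness of [g] on [K] controls the first,
    local integrability of [phi] the second. *)
Lemma mild_on_limit (K : set X) (phis : nat -> R -> R) (psis : nat -> R -> X)
    phi psi (xs : nat -> R -> X) y (a b : R) : compact K -> a <= b ->
  L1loc_cvg0 (fun n r => `|phis n r - phi r|) ->
  L1loc_cvg0 (fun n r => `|psis n r - psi r|) ->
  (exists c : R, upint `[a, b] (fun r => `|phi r|) c%:E) ->
  (\forall n \near \oo, mild_on T g (phis n) (psis n) (xs n) a b) ->
  (forall n t, K (xs n t)) -> locally_uniform_cvg xs y ->
  mild_on T g phi psi y a b.
Proof.
move=> cK ab cphi cpsi [c hc] hm xK xy.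
have [h [h0 Hh]] := semigroup_bound hT (b - a).
have [C [C0 HC]] : exists C, 0 < C /\ forall p, K p -> `|g p| <= C.
  have [C [C0 HC]] := bounded_set_le (compact_bounded
    (continuous_compact (continuous_subspaceT hg) cK)).
  by exists C; split=> // p Kp; apply: HC; exists p.
have [eps [eps0 epsc _]] := @summable_sequence R.
pose A := `|a| + `|b|.
have inA t : a <= t -> t <= b -> `|t| <= A.
  move=> ta tb; rewrite ler_norml; apply/andP; split.
    have := ler_norm (- a); rewrite normrN /A; have := normr_ge0 b; lra.
  by have := ler_norm b; rewrite /A; have := normr_ge0 a; lra.
(* Monotonicity of [k] is irrelevant here: the indices serve to give explicit errors [eps m], from
   which the dominating function [w] is built. *)
have /choice[k kP] (m : nat) : exists n, [/\
    mild_on T g (phis n) (psis n) (xs n) a b,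
    upint `[a, b] (fun r => `|phis n r - phi r|) (eps m)%:E,
    upint `[a, b] (fun r => `|psis n r - psi r|) (eps m)%:E,
    forall t, a <= t -> t <= b -> `|xs n t - y t| <= eps m &
    forall t, a <= t -> t <= b -> `|g (xs n t) - g (y t)| <= eps m].
  have [d [d0 Hd]] := compact_uniform_continuity cK hg (eps0 m).
  have [n [[h1 h2] [h3 [h4 h5]]]] := filter_ex (filterI
    (filterI hm (xy A d d0)) (filterI (xy A _ (eps0 m))
    (filterI (cphi a b _ (eps0 m)) (cpsi a b _ (eps0 m))))).
  exists n; split=> // t ta tb.
    exact/h3/inA.
  by apply: Hd => //; exact/h2/inA.
pose w m r := h * (C * `|phis (k m) r - phi r| + (eps m * `|phi r| +
  `|psis (k m) r - psi r|)).
pose e m := h * (C * eps m + (eps m * c + eps m)).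
have hb m : is_bochner_integral `[a, b]
    (fun s => T (b - s) (phis (k m) s *: g (xs (k m) s) + psis (k m) s))
    (xs (k m) b - T (b - a) (xs (k m) a)) by have [] := kP m.
apply: (bochner_limit (w := w) (c := fun m => (e m)%:E) _ hb) => //.
- move=> m r /=; rewrite in_itv /= => /andP[ar rb].
  rewrite -linearB/=; apply: (le_trans (Hh _ _ _ _)).
  + by rewrite subr_ge0.
  + by rewrite lerD2l lerN2.
  have [_ _ _ _ gm] := kP m.
  rewrite ler_wpM2l ?(ltW h0)//.
  have -> : phis (k m) r *: g (xs (k m) r) + psis (k m) r -
      (phi r *: g (y r) + psi r) =
      (phis (k m) r - phi r) *: g (xs (k m) r) +
      (phi r *: (g (xs (k m) r) - g (y r)) + (psis (k m) r - psi r)).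
    by rewrite scalerBl scalerBr addrA !subrKA opprD addrACA.
  rewrite (le_trans (ler_normD _ _))// lerD//.
    by rewrite normrZ mulrC ler_wpM2r// HC.
  rewrite (le_trans (ler_normD _ _))// lerD2r normrZ mulrC ler_wpM2r//.
  exact: gm.
- move=> m; have [_ u1 u2 _ _] := kP m.
  rewrite /e EFinM EFinD EFinM EFinD EFinM.
  apply: upintZ => //; first exact: ltW.
  apply: upintD => //; first by apply: upintZ => //; exact: ltW.
  by apply: upintD => //; apply: upintZ => //; exact: ltW.
- apply: cvg_EFin; first exact: nearW.
  have -> : 0 = h * (C * 0 + (0 * c + 0)) :> R by rewrite mulr0 mul0r !addr0 mulr0.
  apply: cvgM; first exact: cvg_cst.
  apply: cvgD; first by apply: cvgM => //; exact: cvg_cst.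
  by apply: cvgD => //; apply: cvgM => //; exact: cvg_cst.
- have xc t : a <= t -> t <= b -> (fun m => xs (k m) t) @ \oo --> y t.
    move=> ta tb; apply/subr_cvg0; apply: norm_cvg0.
    apply: (squeeze_cvgr _ (cvg_cst 0) epsc); apply: nearW => m.
    by rewrite normr_ge0; have [_ _ _ -> //] := kP m.
  apply: cvgB; first by apply: xc.
  have [Tc _ _ _] := hT.
  by apply: continuous_cvg; [apply: Tc; rewrite subr_ge0|exact: xc].
Qed.

End mild.

(** * Precompactness and existence of minimal solutions *)

Lemma bochner_ext (R : realType) (Y : normedModType R) (D : set R) (u u' : R -> Y)
    (v : Y) : (forall r, D r -> u r = u' r) ->
  is_bochner_integral D u v -> is_bochner_integral D u' v.
Proof.
move=> uu' [s [ss su sc sv]]; exists s; split=> //.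
  by apply: filterS su => r su Dr; rewrite -uu'//; exact: su.
apply: cvg_trans sc; apply: near_eq_cvg; apply: nearW => n.
by apply: eq_integral => r /[!inE] Dr; rewrite uu'.
Qed.

Section precompact.
Context {R : realType}.

Lemma precompact_finite_cover (X : normedModType R) (A : set X) (eps : R) :
  precompact A -> 0 < eps ->
  exists s : seq X, forall x, A x -> exists2 c, c \in s & `|c - x| <= eps.
Proof.
rewrite precompactE compact_cover => cA eps0.
have [||s _ As] := cA X setT (fun c => ball c eps).
- by move=> c _; exact: ball_open.
- by move=> x _; exists x => //; exact: ballxx.
exists (finmap.enum_fset s) => x Ax; have [c /= cs cx] := As x (subset_closure Ax).
by exists c => //; move: cx; rewrite -ball_normE => /ltW.
Qed.

Lemma ultra_finite_cover (I : eqType) (U : Type) (F : set_system U)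
    (P : I -> set U) (s : seq I) : UltraFilter F ->
  F [set x | exists2 i, i \in s & P i x] -> exists i, F (P i).
Proof.
move=> FU; apply: contraPP => nF.
have nFs : F [set x | forall i, i \in s -> ~ P i x].
  apply: filter_seq => i; have [] // := in_ultra_setVsetC (P i) FU.
  by move=> FPi; exfalso; apply: nF; exists i.
move=> Fs; have [x [[i si Pix] nP]] := filter_ex (filterI Fs nFs).
exact: nP si Pix.
Qed.

(** An ultrafilter on the closure contains a ball of every prescribed radius, by the finite covers;
    it is therefore Cauchy and converges by completeness. *)
Lemma totally_bounded_precompact (X : completeNormedModType R) (A : set X) :
  (forall eps : R, 0 < eps -> exists s : seq X,
    forall x, A x -> exists2 c, c \in s & `|c - x| <= eps) ->
  precompact A.
Proof.
move=> tA; rewrite precompactE compact_ultra => F FU FA.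
have PF : ProperFilter F by exact: ultra_proper.
have : cauchy F.
  apply: cauchy_exP => eps eps0.
  have e40 : 0 < eps / 4 by rewrite divr_gt0.
  have [s Hs] := tA _ e40.
  apply: (@ultra_finite_cover _ _ F (fun c => ball c eps) s FU).
  apply: filterS FA => x.
  move=> /(_ _ (nbhsx_ballx x _ e40)) [a [Aa xa]].
  have [c cs ca] := Hs a Aa; exists c => //.
  rewrite -ball_normE /= -(subrKA a) (le_lt_trans (ler_normD _ _))//.
  move: xa; rewrite -ball_normE /= => xa.
  by rewrite (distrC a x); lra.
move=> /cauchy_cvgP/cvg_ex[x Fx]; exists x; split=> //.
apply: closed_closure => B /Fx FB.
by have [z [Az Bz]] := filter_ex (filterI FA FB); exists z.
Qed.

End precompact.

(** * Solutions with values in a compact set *)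

Section solutions.
Context {R : realType} {X : completeNormedModType R} (T : R -> {linear X -> X}).
Hypothesis hT : C0_semigroup T.
Variable g : X -> X.
Hypothesis hg : continuous g.
Variable K : set X.
Hypothesis hK : compact K.
Implicit Types (phi : R -> R) (psi : R -> X) (x y : R -> X).

(** Equicontinuity is included because hull coefficients are not known to be [AAS1]; for the
    original equation it follows from the other two conditions, see [K_solutionP]. *)
Definition K_solution phi psi x : Prop :=
  [/\ forall t, K (x t), uniformly_equicontinuous (fun _ : unit => x) &
      forall a b, a <= b -> mild_on T g phi psi x a b].

Lemma K_solution_shift phi psi x (s : R) : K_solution phi psi x ->
  K_solution (fun r => phi (r + s)) (fun r => psi (r + s)) (fun r => x (r + s)).
Proof.
move=> [Kx ex mx]; split=> [t|eps eps0|a b ab]; first exact: Kx.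
- have [d [d0 H]] := ex _ eps0; exists d; split=> // i t r tr rt.
  by apply: (H i); rewrite ?lerD2r// addrAC lerD2r.
- by apply: mild_on_shift; apply: mx; rewrite lerD2r.
Qed.

Lemma uniformly_equicontinuous_shift x (s : nat -> R) :
  uniformly_equicontinuous (fun _ : unit => x) ->
  uniformly_equicontinuous (fun n r => x (r + s n)).
Proof.
move=> ex eps eps0; have [d [d0 H]] := ex _ eps0; exists d; split=> // n t r tr rt.
by apply: (H tt); rewrite ?lerD2r// addrAC lerD2r.
Qed.

Lemma K_solution_C_K phi psi x : K_solution phi psi x -> C_K K x.
Proof.
by move=> [Kx ex _]; split=> //; exact: uniformly_equicontinuous_continuous.
Qed.

(** Ascoli followed by stability of the mild formula; it serves forward translates, backward
    translates and constant coefficients. The formula is asked eventually on each interval, as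
    befits half-line solutions shifted far enough. *)
Lemma hull (phis : nat -> R -> R) (psis : nat -> R -> X) phi psi
    (xs : nat -> R -> X) :
  L1_loc (phi : R -> R^o) ->
  L1loc_cvg0 (fun n r => `|phis n r - phi r|) ->
  L1loc_cvg0 (fun n r => `|psis n r - psi r|) ->
  (forall n t, K (xs n t)) -> uniformly_equicontinuous xs ->
  (forall a b, a <= b ->
    \forall n \near \oo, mild_on T g (phis n) (psis n) (xs n) a b) ->
  exists (k : nat -> nat) y,
    [/\ {homo k : m n / (m < n)%N >-> (m < n)%N},
        locally_uniform_cvg (fun n => xs (k n)) y & K_solution phi psi y].
Proof.
move=> lphi cphi cpsi xK ex mx.
have [k [y [hk ky Ky ey]]] := ascoli hK xK ex.
exists k, y; split=> //; split=> // a b ab.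
apply: (mild_on_limit hT hg hK ab (L1loc_cvg0_sub hk cphi)
  (L1loc_cvg0_sub hk cpsi) _ _ _ ky) => [||n t].
- exact: L1_loc_upint lphi.
- exact: increasing_cvg_infty hk _ (mx a b ab).
- exact: xK.
Qed.

Section AAS.
Variables (phi : R -> R) (psi : R -> X).
Hypothesis hphi : AAS1 (phi : R -> R^o).
Hypothesis hpsi : AAS1 psi.

Lemma AAS1_common_subsequence (s' : nat -> R) :
  exists (k : nat -> nat) (phi1 : R -> R) (psi1 : R -> X),
  [/\ {homo k : m n / (m < n)%N >-> (m < n)%N}, L1_loc (phi1 : R -> R^o),
    L1loc_cvg0 (fun n r => `|phi (r + s' (k n)) - phi1 r|) /\
    L1loc_cvg0 (fun n r => `|psi (r + s' (k n)) - psi1 r|) &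
    L1loc_cvg0 (fun n r => `|phi1 (r - s' (k n)) - phi r|) /\
    L1loc_cvg0 (fun n r => `|psi1 (r - s' (k n)) - psi r|)].
Proof.
have [k1 [phi1 [hk1 l1 c1 d1]]] := AAS1_subsequence s' hphi.
have [k2 [psi1 [hk2 l2 c2 d2]]] := AAS1_subsequence (s' \o k1) hpsi.
exists (k1 \o k2), phi1, psi1; split=> //.
- by move=> m n mn; apply: hk1; exact: hk2.
- by split=> //; exact: (L1loc_cvg0_sub hk2 c1).
- by split=> //; exact: (L1loc_cvg0_sub hk2 d1).
Qed.

Lemma K_mild_equicontinuous (eps : R) : 0 < eps ->
  exists d, 0 < d /\ forall x a b, a <= b -> b <= a + d ->
    (forall t, a <= t -> t <= b -> K (x t)) ->
    mild_on T g phi psi x a b -> `|x b - x a| <= eps.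
Proof.
have [C [C0 HC]] : exists C, 0 < C /\ forall p, K p -> `|g p| <= C.
  have [C [C0 HC]] := bounded_set_le (compact_bounded
    (continuous_compact (continuous_subspaceT hg) hK)).
  by exists C; split=> // p Kp; apply: HC; exists p.
(* Indexing by all functions through [id] makes [d] independent of the solution. *)
apply: (mild_on_equicontinuous hT (C := C) (I := R -> X) id hK (ltW C0) HC).
- by move=> e e0; exact: (AAS1_uniformly_integrable hphi e0).
- by move=> e e0; exact: (AAS1_uniformly_integrable hpsi e0).
Qed.

Lemma K_solutionP x : K_solution phi psi x <->
  (forall t, K (x t)) /\ (forall a b, a <= b -> mild_on T g phi psi x a b).
Proof.
split=> [[]//|[Kx mx]]; split=> // eps eps0.
have [d [d0 H]] := K_mild_equicontinuous eps0; exists d; split=> // _ s t st ts.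
by apply: H => //; exact: mx.
Qed.

Lemma K_solution_F_K x :
  K_solution phi psi x <-> F_K T (fun t p => phi t *: g p + psi t) K x.
Proof.
split=> [sx|[[_ mx] [xc Kx]]].
  have ck := K_solution_C_K sx; have [_ _ mx] := sx.
  split=> //; split; first exact/continuous_subspaceT/ck.1.
  by move=> a b _ _ ab; exact: mx.
by apply/K_solutionP; split=> // a b ab; exact: mx.
Qed.

(* The initial time is sent to minus infinity by integer translations; frozen
   before [t0], the solution stays equicontinuous.  The limit solves an equation
   of the hull and is translated back. *)
Lemma K_solution_exists x0 t0 :
  (forall t, t0 <= t -> K (x0 t)) ->
  (forall a b, t0 <= a -> a <= b -> mild_on T g phi psi x0 a b) ->
  exists x, K_solution phi psi x.
Proof.
move=> K0 m0.
have [k [phi1 [psi1 [hk l1 [c1 c2] [d1 d2]]]]] :=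
  AAS1_common_subsequence (fun n => n%:R).
have kn n : (n <= k n)%N.
  by elim: n => // n IH; apply: (leq_ltn_trans IH); exact: hk.
pose xs n t := x0 (Num.max t0 (t + (k n)%:R)).
have [k1 [y [_ _ sy]]] : exists (k1 : nat -> nat) y,
    [/\ {homo k1 : m n / (m < n)%N >-> (m < n)%N},
        locally_uniform_cvg (fun n => xs (k1 n)) y & K_solution phi1 psi1 y].
  apply: (hull l1 c1 c2) => [n t|eps eps0|a b ab].
  - by apply: K0; rewrite le_max lexx.
  - have [d [d0 H]] := K_mild_equicontinuous eps0.
    exists d; split=> // n s t st ts.
    have h1 : t0 <= Num.max t0 (s + (k n)%:R) by rewrite le_max lexx.
    have h2 : Num.max t0 (s + (k n)%:R) <= Num.max t0 (t + (k n)%:R).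
      by rewrite ge_max !le_max lexx lerD2r st orbT.
    apply: (H x0 (Num.max t0 (s + (k n)%:R))) => //; last exact: m0.
    + rewrite ge_max; apply/andP; split.
        by rewrite (le_trans h1)// lerDl ltW.
      apply: (@le_trans _ _ (s + (k n)%:R + d)); first by rewrite addrAC lerD2r.
      by rewrite lerD2r le_max lexx orbT.
    + by move=> r r1 _; apply: K0; exact: le_trans r1.
  - near=> n.
    have an : t0 <= a + (k n)%:R.
      rewrite -lerBlDl (le_trans (ltW (truncnS_gt _)))// ler_nat.
      apply: leq_trans (kn n); near: n; by exists (Num.trunc (t0 - a)).+1.
    have : mild_on T g phi psi x0 (a + (k n)%:R) (b + (k n)%:R).
      by apply: m0 => //; rewrite lerD2r.
    move=> /mild_on_shift; rewrite /mild_on /xs.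
    have E t : a <= t -> Num.max t0 (t + (k n)%:R) = t + (k n)%:R.
      by move=> at'; apply/max_idPr; rewrite (le_trans an)// lerD2r.
    rewrite !E//; apply: bochner_ext => r.
    by rewrite /= in_itv /= => /andP[ar _]; rewrite E.
have [k2 [z [_ _ sz]]] : exists (k2 : nat -> nat) z,
    [/\ {homo k2 : m n / (m < n)%N >-> (m < n)%N},
        locally_uniform_cvg (fun n r => y (r - (k (k2 n))%:R)) z &
        K_solution phi psi z].
  apply: (hull hphi.1 d1 d2 (xs := fun n r => y (r - (k n)%:R)))
    => [n t||a b ab].
  - by have [Ky _ _] := sy.
  - by have [_ ey _] := sy; exact: (uniformly_equicontinuous_shift _ ey).
  - by apply: nearW => n; have [_ _] := K_solution_shift (- (k n)%:R) sy; exact.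
by exists z.
Unshelve. all: by end_near. Qed.

Variable lam : (R -> X) -> R.
Hypothesis hlam : subvariant K lam.
Local Notation f := (fun t p => phi t *: g p + psi t).

Lemma minimal_solution_exists : (exists x, K_solution phi psi x) ->
  exists x, minimal_solution T f K lam x.
Proof.
move=> [x sx]; pose S := [set (lam y)%:E | y in F_K T f K].
have S0 : S != set0.
  by apply/set0P; exists (lam x)%:E, x => //; exact/K_solution_F_K.
(* The infimum may still be [-oo] here; its attainment at [y] is what excludes this. *)
have [u Su uS] := ereal_inf_seq S0.
have /choice[xs xsP] n : exists y, K_solution phi psi y /\ (lam y)%:E = u n.
  by have [y /K_solution_F_K sy yu] := Su n; exists y.
(* With constant coefficient sequences, [hull] gives compactness of the solution set of the equation
   itself. *)
have c0 (Y : normedModType R) (v : R -> Y) :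
    L1loc_cvg0 (fun (n : nat) r => `|v r - v r|).
  move=> a b eps eps0; apply: nearW => n.
  apply: upint_le (lexx _) (upint0 `[a, b] (c := eps%:E) _).
    by apply: aeW => r _ /=; rewrite subrr normr0.
  by rewrite lee_fin ltW.
have [k [y [hk ky sy]]] : exists (k : nat -> nat) y,
    [/\ {homo k : m n / (m < n)%N >-> (m < n)%N},
        locally_uniform_cvg (fun n => xs (k n)) y & K_solution phi psi y].
  apply: (hull hphi.1 (c0 R^o phi) (c0 _ psi)) => [n t|eps eps0|a b ab].
  - by have [[Kx _ _] _] := xsP n.
  - have [d [d0 H]] := K_mild_equicontinuous eps0; exists d; split=> // n s t st ts.
    by have [[Kx _ mx] _] := xsP n; apply: H => //; exact: mx.
  - by apply: nearW => n; have [[_ _ mx] _] := xsP n; exact: mx.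
exists y; split; first exact/K_solution_F_K.
apply/eqP; rewrite eq_le; apply/andP; split; last first.
  by apply: ereal_inf_lbound; exists y => //; exact/K_solution_F_K.
have uk : (fun n => (lam (xs (k n)))%:E) @ \oo --> ereal_inf S.
  have -> : (fun n => (lam (xs (k n)))%:E) = u \o k.
    by apply/funext => n /=; exact: (xsP _).2.
  exact: cvg_comp (increasing_cvg_infty hk) uS.
rewrite -(cvg_limn_einf_sup uk).1; apply: hlam.2.
- by move=> n; exact: K_solution_C_K (xsP _).1.
- exact: K_solution_C_K sy.
- exact: locally_uniform_cvg_family.
Qed.

End AAS.
End solutions.

(** * Almost automorphy of minimal solutions *)

Section recurrence.
Context {R : realType} {X : completeNormedModType R} (T : R -> {linear X -> X}).
Hypothesis hT : C0_semigroup T.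
Variable g : X -> X.
Hypothesis hg : continuous g.
Variables (phi : R -> R) (psi : R -> X).
Hypothesis hphi : AAS1 (phi : R -> R^o).
Hypothesis hpsi : AAS1 psi.
Local Notation f := (fun t p => phi t *: g p + psi t).

(* Passing to the limit along [s'] and back gives a solution [z] with
   [lam z <= lam x]; it is minimal, hence equal to [x]. *)
Lemma unique_minimal_compact_almost_automorphic (K : set X) lam x :
  compact K -> subvariant K lam -> unique (minimal_solution T f K lam) x ->
  compact_almost_automorphic x.
Proof.
move=> hK hlam [[/(K_solution_F_K hT hg hK hphi hpsi) sx xinf] xuniq].
have lamT y (s : R) : C_K K y -> lam (fun r => y (r + s)) = lam y.
  move=> Ky; rewrite -(hlam.1 y s Ky); congr lam.
  by apply/funext => r; rewrite addrC.
have lam_const (c : R) (xs : nat -> R -> X) y :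
    (forall n, C_K K (xs n)) -> (forall n, lam (xs n) = c) -> C_K K y ->
    locally_uniform_cvg xs y -> lam y <= c.
  move=> Kxs lamxs Ky xy; rewrite -lee_fin.
  have cc : (fun n => (lam (xs n))%:E) @ \oo --> c%:E.
    by under eq_fun do rewrite lamxs; exact: cvg_cst.
  rewrite -(cvg_limn_einf_sup cc).1; apply: hlam.2 => //.
  exact: locally_uniform_cvg_family.
split=> [|s']; first exact: (K_solution_C_K sx).1.
have [k [phi1 [psi1 [hk l1 [c1 c2] [d1 d2]]]]] :=
  AAS1_common_subsequence hphi hpsi s'.
have sxs n := K_solution_shift (s' (k n)) sx.
have [k1 [y [hk1 xy sy]]] : exists (k1 : nat -> nat) y,
    [/\ {homo k1 : m n / (m < n)%N >-> (m < n)%N},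
        locally_uniform_cvg (fun n r => x (r + s' (k (k1 n)))) y &
        K_solution T g K phi1 psi1 y].
  apply: (hull hT hg hK l1 c1 c2 (xs := fun n r => x (r + s' (k n))))
    => [n t||a b ab].
  - by have [Kx _ _] := sx.
  - by have [_ ex _] := sx; exact: (uniformly_equicontinuous_shift _ ex).
  - by apply: nearW => n; have [_ _] := sxs n; exact.
have sys n := K_solution_shift (- s' (k (k1 n))) sy.
have [k2 [z [hk2 yz sz]]] : exists (k2 : nat -> nat) z,
    [/\ {homo k2 : m n / (m < n)%N >-> (m < n)%N},
        locally_uniform_cvg (fun n r => y (r - s' (k (k1 (k2 n))))) z &
        K_solution T g K phi psi z].
  apply: (hull hT hg hK hphi.1 (L1loc_cvg0_sub hk1 d1) (L1loc_cvg0_sub hk1 d2)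
    (xs := fun n r => y (r - s' (k (k1 n))))) => [n t||a b ab].
  - by have [Ky _ _] := sy.
  - by have [_ ey _] := sy; exact: (uniformly_equicontinuous_shift _ ey).
  - by apply: nearW => n; have [_ _] := sys n; exact.
have Kx := K_solution_C_K sx; have Ky := K_solution_C_K sy.
have Kz := K_solution_C_K sz.
have lyx : lam y <= lam x.
  apply: (lam_const _ (fun n r => x (r + s' (k (k1 n))))) => // n.
    exact: K_solution_C_K (sxs _).
  exact: lamT.
have lzy : lam z <= lam y.
  apply: (lam_const _ (fun n r => y (r - s' (k (k1 (k2 n)))))) => // n.
    exact: K_solution_C_K (sys _).
  exact: lamT.
have Fz : F_K T f K z by exact/(K_solution_F_K hT hg hK hphi hpsi).
have xz : x = z.
  apply: xuniq; split=> //; apply/eqP; rewrite eq_le; apply/andP; split.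
    by rewrite -xinf lee_fin (le_trans lzy).
  by apply: ereal_inf_lbound; exists z.
(* One subsequence must serve both directions, so the forward convergence is restricted along
   [k2]. *)
exists (k \o k1 \o k2), y; split.
- by move=> m n mn; apply/hk/hk1/hk2.
- apply: locally_uniform_cvg_family => a eps eps0.
  exact: increasing_cvg_infty hk2 _ (xy a eps eps0).
- by rewrite xz; exact: locally_uniform_cvg_family.
Qed.

(** * Relative compactness of a bounded orbit *)

Hypothesis hTc : forall t : R, 0 < t -> compact_operator (T t).

(* x0 t = T h (x0 (t - h)) + (small integral term), with [T h] compact. *)
Lemma bounded_mild_solution_precompact (t0 : R) (x0 : R -> X) :
  (forall B : set X, bounded_set B -> bounded_set (g @` B)) ->
  mild_solution T f `[t0, +oo[ x0 -> bounded_set (x0 @` `[t0, +oo[) ->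
  precompact (x0 @` `[t0, +oo[).
Proof.
move=> hgb [x0c x0m] x0b; apply: totally_bounded_precompact => eps eps0.
have [C [C0 HC]] := bounded_set_le (hgb _ x0b).
have [M [M0 HM]] := semigroup_bound hT 1.
have MC : 0 < M * (C + 1) by rewrite mulr_gt0// ltr_wpDl// ltW.
pose e1 := eps / 2 / (M * (C + 1)).
have e10 : 0 < e1 by rewrite !divr_gt0.
have [d1 [d10 H1]] := AAS1_uniformly_integrable hphi e10.
have [d2 [d20 H2]] := AAS1_uniformly_integrable hpsi e10.
pose h := Num.min 1 (Num.min d1 d2).
have h0 : 0 < h by rewrite !lt_min ltr01 d10.
have [h1 hd1 hd2] : [/\ h <= 1, h <= d1 & h <= d2].
  by split; rewrite /h !ge_min ?lexx ?orbT.
have e20 : 0 < eps / 2 by rewrite divr_gt0.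
have [s1 Hs1] := precompact_finite_cover (hTc h0 x0b) e20.
(* For [t] below [t0 + h] the time [t - h] precedes [t0]; this initial arc is covered separately, as
   a continuous image of a segment. *)
have cI : compact (x0 @` `[t0, t0 + h]).
  apply: continuous_compact; last exact: segment_compact.
  apply: continuous_subspaceW x0c => r /=; rewrite !in_itv /= andbT.
  by case/andP.
have [s2 Hs2] := precompact_finite_cover
  (compact_precompact (@norm_hausdorff _ _) cI) eps0.
exists (s1 ++ s2) => _ [t /= + <-]; rewrite in_itv /= andbT => tt0.
have [th|/ltW th] := leP t (t0 + h).
  have [c cs ct] := Hs2 (x0 t) (ex_intro2 _ _ t
    (introT andP (conj tt0 th)) erefl).
  by exists c => //; rewrite mem_cat cs orbT.
have th0 : t0 <= t - h by rewrite lerBrDr.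
have tht : t - h <= t by rewrite lerBlDr lerDl ltW.
have [c cs ct] : exists2 c, c \in s1 & `|c - T h (x0 (t - h))| <= eps / 2.
  apply: Hs1; exists (x0 (t - h)) => //; exists (t - h) => //.
  by rewrite /= in_itv /= andbT.
exists c; first by rewrite mem_cat cs.
rewrite -(subrKA (T h (x0 (t - h)))) (le_trans (ler_normD _ _))//.
rewrite [leRHS]splitr lerD//.
have m : mild_on T g phi psi x0 (t - h) t.
  by apply: x0m => //=; rewrite in_itv /= andbT.
have := mild_on_norm tht _ m (C := C) (h := M) (e1 := e1) (e2 := e1).
rewrite (_ : t - (t - h) = h); last by rewrite opprB addrC subrK.
rewrite (distrC (x0 t)).
have -> : M * (C * e1 + e1) = eps / 2.
  by rewrite -[X in _ + X]mul1r -mulrDl mulrA /e1 mulrC divfK// gt_eqF.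
apply; [by lra| |exact: ltW|exact: HM|exact: ltW| |].
- move=> r tr _; apply: HC; exists (x0 r) => //; exists r => //.
  by rewrite /= in_itv /= andbT (le_trans th0).
- by apply: H1; lra.
- by apply: H2; lra.
Qed.

End recurrence.

(** The first clause makes the closure of the orbit compact, so that a compact [K] containing the
    orbit, as clause (i) asks, is available. *)
Theorem theorem3p3 (R : realType) (X : completeNormedModType R)
    (K : set X) (hK : compact K)
    (T : R -> {linear X -> X}) (D : set X) (A : X -> X)
    (hT : C0_semigroup T)
    (hA : infinitesimal_generator T D A)
    (hTc : forall t : R, 0 < t -> compact_operator (T t))
    (phi : R -> R) (psi : R -> X) (g : X -> X)
    (hphi : AAS1 (phi : R -> R^o))
    (hphi_bnd : finite_norm (@lebesgue_measure R) +oo%E phi)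
    (hpsi : AAS1 psi)
    (hg : continuous g)
    (hg_bnd : forall B : set X, bounded_set B -> bounded_set (g @` B))
    (f : R -> X -> X)
    (hf : forall t x, f t x = phi t *: g x + psi t)
    (t0 : R) (x0 : R -> X)
    (hx0 : mild_solution T f `[t0, +oo[ x0)
    (hx0_bnd : bounded_set (x0 @` `[t0, +oo[)) :
  [/\ precompact (x0 @` `[t0, +oo[),
      x0 @` `[t0, +oo[ `<=` K ->
        forall lam : (R -> X) -> R, subvariant K lam ->
        exists x : R -> X, minimal_solution T f K lam x &
      forall lam : (R -> X) -> R, subvariant K lam ->
      forall x : R -> X, unique (minimal_solution T f K lam) x ->
        compact_almost_automorphic x].
Proof.
have fE : f = (fun t p => phi t *: g p + psi t).
  by apply/funext => t; apply/funext => p; exact: hf.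
rewrite {}fE {f hf} in hx0 *; split.
- exact: bounded_mild_solution_precompact hg_bnd hx0 hx0_bnd.
- move=> x0K lam hlam.
  apply: (minimal_solution_exists hT hg hK hphi hpsi hlam).
  apply: (K_solution_exists hT hg hK hphi hpsi (x0 := x0) (t0 := t0)).
    by move=> t t0t; apply: x0K; exists t => //; rewrite /= in_itv /= andbT.
  move=> a b t0a ab; apply: hx0.2 => //=; rewrite in_itv /= andbT//.
  exact: le_trans ab.
- move=> lam hlam x; exact: unique_minimal_compact_almost_automorphic.
Qed.
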